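(* (1) $\mathsf{RCA}_0$ proves $\mathsf{FIPP}_2 \to \mathsf{IPP}$. (2) $\mathsf{RCA}_0$ proves $\mathsf{FIPP}_3 \to \mathsf{IPP}$.
   Context: Work in second-order arithmetic ($\mathsf{RCA}_0$ as in Simpson, Subsystems of Second Order Arithmetic). For $i\in\mathbb N$, $[i]=\{j: j\le i\}$, with $[-1]=\emptyset$. $\mathrm{Seq}$ is the set of codes of finite sequences; for $l\in\mathrm{Seq}$, $A_l=\{l(i): i<\mathrm{lh}\, l\}$. $|A|=m$ means there is a bijection $[m-1]\to A$; $|A|>m$ means $|A|=m'$ for some $m'>m$. $F:\mathbb N\to\mathbb N$ is extensional if $A_l=A_{l'}$ implies $F(l)=F(l')$ for $l,l'\in\mathrm{Seq}$. A sequence $(l_m)$ is a nested sequence with union if each $l_m\in\mathrm{Seq}$, $A_{l_m}\subseteq A_{l_{m+1}}$ for all $m$, and the set $\bigcup_m A_{l_m}$ exists. $F\in AS$ means $F$ is extensional and for every nested sequence with union $(l_m)$ there is $i$ with $F(l_i)=F(l_j)$ for all $j\ge i$. A sequence $(l_m)$ of elements of $\mathrm{Seq}$ weakly converges to an infinite set $A$ if for every finite set $B$ there is $i$ with $A_{l_j}\cap B=A\cap B$ for all $j\ge i$; it is weakly convergent if it weakly converges to some infinite set. $F\in ASNIS$ means $F$ is extensional and for every weakly convergent $(l_m)$ there is $i$ with $F(l_i)=F(l_j)$ for all $j\ge i$. $\mathsf{IPP}$: $\forall n\,\forall f:\mathbb N\to[n]\,\exists c\in[n]\,[f^{-1}(c)$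 is infinite$]$. $\mathsf{FIPP}_2$: $\forall n\,\forall F\in AS\,\exists k\,\forall f:[k]\to[n]\,\exists l\in\mathrm{Seq}\,[A_l\subseteq[k]\wedge|A_l|>F(l)\wedge f|_{A_l}$ is constant$]$. $\mathsf{FIPP}_3$: $\forall n\,\forall F\in ASNIS\,\exists k\,\forall f:[k]\to[n]\,\exists l\in\mathrm{Seq}\,\exists c\in[n]\,[A_l=f^{-1}(c)\wedge|A_l|>F(l)]$. *)

(* Defs.v *)
From Stdlib Require Import List.
Import ListNotations.

(** * The language of second-order arithmetic

    Two-sorted de Bruijn syntax: number variables and set variables have separate
    index spaces, so [All1]/[Ex1] bind number index 0 only and [All2]/[Ex2] bind
    set index 0 only. *)

Inductive term : Type :=
| Var (i : nat)
| Zero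
| One
| Plus (t u : term)
| Times (t u : term).

Inductive form : Type :=
| Bot
| Eq (t u : term)
| Lt (t u : term)
| Mem (t : term) (X : nat)
| Imp (p q : form)
| And (p q : form)
| Or (p q : form)
| All1 (p : form)
| Ex1 (p : form)
| All2 (p : form)
| Ex2 (p : form).

Definition Neg (p : form) : form := Imp p Bot.
Definition Iff (p q : form) : form := And (Imp p q) (Imp q p).

Fixpoint tsubst (s : nat -> term) (t : term) : term :=
  match t with
  | Var i => s i
  | Zero => Zero
  | One => One
  | Plus t u => Plus (tsubst s t) (tsubst s u)
  | Times t u => Times (tsubst s t) (tsubst s u)
  end.

Definition tshift : term -> term := tsubst (fun i => Var (S i)).

Definition up1 (s : nat -> term) (i : nat) : term :=
  match i with 0 => Var 0 | S i => tshift (s i) end.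

Definition up2 (r : nat -> nat) (X : nat) : nat :=
  match X with 0 => 0 | S X => S (r X) end.

(** The only set terms are set variables, so on the set sort a substitution is a
    renaming. *)
Fixpoint subst (s : nat -> term) (r : nat -> nat) (p : form) : form :=
  match p with
  | Bot => Bot
  | Eq t u => Eq (tsubst s t) (tsubst s u)
  | Lt t u => Lt (tsubst s t) (tsubst s u)
  | Mem t X => Mem (tsubst s t) (r X)
  | Imp p q => Imp (subst s r p) (subst s r q)
  | And p q => And (subst s r p) (subst s r q)
  | Or p q => Or (subst s r p) (subst s r q)
  | All1 p => All1 (subst (up1 s) r p)
  | Ex1 p => Ex1 (subst (up1 s) r p)
  | All2 p => All2 (subst s (up2 r) p)
  | Ex2 p => Ex2 (subst s (up2 r) p)
  end.

Definition shift1 : form -> form := subst (fun i => Var (S i)) (fun X => X).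
Definition shift2 : form -> form := subst Var S.

Definition inst1 (t : term) : form -> form :=
  subst (fun i => match i with 0 => t | S i => Var i end) (fun X => X).
Definition inst2 (Y : nat) : form -> form :=
  subst Var (fun X => match X with 0 => Y | S X => X end).

(** * Provability

    Natural deduction for classical two-sorted first-order logic with equality on
    the number sort. [prv T G p] : [p] is derivable from the axioms [T] and the
    hypotheses [G]. The eigenvariable conditions constrain [G] but not [T], so an
    axiom with free variables counts as its universal closure. *)
Inductive prv (T : form -> Prop) : list form -> form -> Prop :=
| prv_ax G p : T p -> prv T G p
| prv_hyp G p : In p G -> prv T G p
| prv_impI G p q : prv T (p :: G) q -> prv T G (Imp p q)
| prv_impE G p q : prv T G (Imp p q) -> prv T G p -> prv T G q
| prv_raa G p : prv T (Neg p :: G) Bot -> prv T G p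
| prv_andI G p q : prv T G p -> prv T G q -> prv T G (And p q)
| prv_andE1 G p q : prv T G (And p q) -> prv T G p
| prv_andE2 G p q : prv T G (And p q) -> prv T G q
| prv_orI1 G p q : prv T G p -> prv T G (Or p q)
| prv_orI2 G p q : prv T G q -> prv T G (Or p q)
| prv_orE G p q r :
    prv T G (Or p q) -> prv T (p :: G) r -> prv T (q :: G) r -> prv T G r
| prv_all1I G p : prv T (map shift1 G) p -> prv T G (All1 p)
| prv_all1E G p t : prv T G (All1 p) -> prv T G (inst1 t p)
| prv_ex1I G p t : prv T G (inst1 t p) -> prv T G (Ex1 p)
| prv_ex1E G p q :
    prv T G (Ex1 p) -> prv T (p :: map shift1 G) (shift1 q) -> prv T G q
| prv_all2I G p : prv T (map shift2 G) p -> prv T G (All2 p)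
| prv_all2E G p Y : prv T G (All2 p) -> prv T G (inst2 Y p)
| prv_ex2I G p Y : prv T G (inst2 Y p) -> prv T G (Ex2 p)
| prv_ex2E G p q :
    prv T G (Ex2 p) -> prv T (p :: map shift2 G) (shift2 q) -> prv T G q
| prv_eq_refl G t : prv T G (Eq t t)
| prv_eq_subst G p t u :
    prv T G (Eq t u) -> prv T G (inst1 t p) -> prv T G (inst1 u p).

Definition proves (T : form -> Prop) (p : form) : Prop := prv T [] p.

(** * Writing formulas with named binders

    An [expr] (resp. [svar], [fml]) is a number term (resp. set variable, formula)
    that can be placed under any number of binders: it receives the number [d] of
    enclosing number quantifiers and the number [e] of enclosing set quantifiers.
    A variable bound when [d] number quantifiers were already open has index
    [d' - S d] at depth [d']. *)

Definition expr : Type := nat -> term.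
Definition svar : Type := nat -> nat.
Definition fml : Type := nat -> nat -> form.

Declare Scope expr_scope.
Delimit Scope expr_scope with expr.
Bind Scope expr_scope with expr.
Declare Scope fml_scope.
Delimit Scope fml_scope with fml.
Bind Scope fml_scope with fml.

Definition fzero : expr := fun _ => Zero.
Definition fone : expr := fun _ => One.
Definition fadd (t u : expr) : expr := fun d => Plus (t d) (u d).
Definition fmul (t u : expr) : expr := fun d => Times (t d) (u d).

Definition fbot : fml := fun _ _ => Bot.
Definition feq (t u : expr) : fml := fun d _ => Eq (t d) (u d).
Definition flt (t u : expr) : fml := fun d _ => Lt (t d) (u d).
Definition fmem (t : expr) (X : svar) : fml := fun d e => Mem (t d) (X e).
Definition fimp (p q : fml) : fml := fun d e => Imp (p d e) (q d e).
Definition fand (p q : fml) : fml := fun d e => And (p d e) (q d e).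
Definition fdisj (p q : fml) : fml := fun d e => Or (p d e) (q d e).
Definition fneg (p : fml) : fml := fun d e => Neg (p d e).
Definition fiff (p q : fml) : fml := fun d e => Iff (p d e) (q d e).
Definition fall1 (p : expr -> fml) : fml :=
  fun d e => All1 (p (fun d' => Var (d' - S d)) (S d) e).
Definition fex1 (p : expr -> fml) : fml :=
  fun d e => Ex1 (p (fun d' => Var (d' - S d)) (S d) e).
Definition fall2 (p : svar -> fml) : fml :=
  fun d e => All2 (p (fun e' => e' - S e) d (S e)).
Definition fex2 (p : svar -> fml) : fml :=
  fun d e => Ex2 (p (fun e' => e' - S e) d (S e)).

Definition sentence (p : fml) : form := p 0 0.

Notation "0" := fzero : expr_scope.
Notation "1" := fone : expr_scope.
Notation "t + u" := (fadd t u) : expr_scope.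
Notation "t * u" := (fmul t u) : expr_scope.

Notation "t = u" := (feq t u) : fml_scope.
Notation "t < u" := (flt t u) : fml_scope.
Notation "t ∈ X" := (fmem t X) (at level 70) : fml_scope.
Notation "¬ p" := (fneg p) (at level 75, right associativity) : fml_scope.
Notation "p ∧ q" := (fand p q) (at level 80, right associativity) : fml_scope.
Notation "p ∨ q" := (fdisj p q) (at level 85, right associativity) : fml_scope.
Notation "p → q" := (fimp p q)
  (at level 99, q at level 200, right associativity) : fml_scope.
Notation "p ↔ q" := (fiff p q) (at level 95, no associativity) : fml_scope.
Notation "∀₁ x .. y , p" := (fall1 (fun x => .. (fall1 (fun y => p)) ..))
  (at level 200, x binder, y binder, right associativity) : fml_scope.
Notation "∃₁ x .. y , p" := (fex1 (fun x => .. (fex1 (fun y => p)) ..))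
  (at level 200, x binder, y binder, right associativity) : fml_scope.
Notation "∀₂ X .. Y , p" := (fall2 (fun X => .. (fall2 (fun Y => p)) ..))
  (at level 200, X binder, Y binder, right associativity) : fml_scope.
Notation "∃₂ X .. Y , p" := (fex2 (fun X => .. (fex2 (fun Y => p)) ..))
  (at level 200, X binder, Y binder, right associativity) : fml_scope.

(** * The axioms of RCA0 *)

Inductive basic_axiom : form -> Prop :=
| ax_succ_neq_zero : basic_axiom (sentence (∀₁ n, ¬ (n + 1 = 0))%fml)
| ax_succ_inj : basic_axiom (sentence (∀₁ m n, m + 1 = n + 1 → m = n)%fml)
| ax_add_zero : basic_axiom (sentence (∀₁ m, m + 0 = m)%fml)
| ax_add_succ : basic_axiom (sentence (∀₁ m n, m + (n + 1) = (m + n) + 1)%fml)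
| ax_mul_zero : basic_axiom (sentence (∀₁ m, m * 0 = 0)%fml)
| ax_mul_succ : basic_axiom (sentence (∀₁ m n, m * (n + 1) = m * n + m)%fml)
| ax_lt_zero : basic_axiom (sentence (∀₁ m, ¬ (m < 0))%fml)
| ax_lt_succ : basic_axiom (sentence (∀₁ m n, m < n + 1 ↔ (m < n ∨ m = n))%fml).

(** [tshift t] keeps the bound variable out of the bound. *)
Inductive bounded : form -> Prop :=
| bounded_bot : bounded Bot
| bounded_eq t u : bounded (Eq t u)
| bounded_lt t u : bounded (Lt t u)
| bounded_mem t X : bounded (Mem t X)
| bounded_imp p q : bounded p -> bounded q -> bounded (Imp p q)
| bounded_and p q : bounded p -> bounded q -> bounded (And p q)
| bounded_or p q : bounded p -> bounded q -> bounded (Or p q)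
| bounded_all t p : bounded p -> bounded (All1 (Imp (Lt (Var 0) (tshift t)) p))
| bounded_ex t p : bounded p -> bounded (Ex1 (And (Lt (Var 0) (tshift t)) p)).

Inductive Sigma01 : form -> Prop :=
| Sigma01_intro p : bounded p -> Sigma01 (Ex1 p).

Inductive Pi01 : form -> Prop :=
| Pi01_intro p : bounded p -> Pi01 (All1 p).

(** In both schemes the distinguished number variable is index 0, and all other
    variables, of either sort, are parameters. *)
Definition induction (p : form) : form :=
  let p_succ :=
    subst (fun i => match i with 0 => Plus (Var 0) One | S i => Var (S i) end)
      (fun X => X) p in
  Imp (And (inst1 Zero p) (All1 (Imp p p_succ))) (All1 p).

Definition delta_comprehension (p q : form) : form :=
  Imp (All1 (Iff p q)) (Ex2 (All1 (Iff (Mem (Var 0) 0) (shift2 p)))).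

Inductive RCA0 : form -> Prop :=
| RCA0_basic p : basic_axiom p -> RCA0 p
| RCA0_induction p : Sigma01 p -> RCA0 (induction p)
| RCA0_comprehension p q : Sigma01 p -> Pi01 q -> RCA0 (delta_comprehension p q).

(** * Coding in RCA0, following Simpson *)

(** A definable class of numbers. *)
Definition cls : Type := expr -> fml.

Definition univ : cls := fun _ => (¬ fbot)%fml.

Definition fle (t u : expr) : fml := (t < u ∨ t = u)%fml.
Notation "t <= u" := (fle t u) : fml_scope.

Definition fpair (i j : expr) : expr := ((i + j) * (i + j) + i)%expr.
Notation "⟨ i , j ⟩" := (fpair i j) (at level 0) : expr_scope.

Definition fdvd (t u : expr) : fml := (∃₁ q, u = t * q)%fml.

(** A finite set is coded through Gödel's beta function by a triple [⟨k,⟨m,n⟩⟩]. *)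
Definition beta_mem (i k m n : expr) : fml := (i < k ∧ fdvd (m * (i + 1) + 1) n)%fml.

Definition code_mem (i c : expr) : fml :=
  (∃₁ k m n, c = ⟨k, ⟨m, n⟩⟩ ∧ beta_mem i k m n)%fml.

(** The code of a finite set is the least triple representing it. *)
Definition is_set_code (c : expr) : fml :=
  (∃₁ k m n, c = ⟨k, ⟨m, n⟩⟩
     ∧ ∀₁ k' m' n', ⟨k', ⟨m', n'⟩⟩ < c →
         ¬ ∀₁ i, beta_mem i k' m' n' ↔ beta_mem i k m n)%fml.

Definition lh_eq (l n : expr) : fml :=
  (∀₁ i, i < n ↔ ∃₁ x, code_mem ⟨i, x⟩ l)%fml.

Definition is_seq : cls := fun l =>
  (is_set_code l
   ∧ (∀₁ z, code_mem z l → ∃₁ i x, z = ⟨i, x⟩)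
   ∧ (∀₁ i x y, code_mem ⟨i, x⟩ l → code_mem ⟨i, y⟩ l → x = y)
   ∧ ∃₁ n, lh_eq l n)%fml.

(** [A_ l] is the class [{l(i) : i < lh l}]. *)
Definition A_ (l : expr) : cls := fun x =>
  (∃₁ n, lh_eq l n ∧ ∃₁ i, i < n ∧ code_mem ⟨i, x⟩ l)%fml.

Definition subcls (P Q : cls) : fml := (∀₁ x, P x → Q x)%fml.
Definition eqcls (P Q : cls) : fml := (∀₁ x, P x ↔ Q x)%fml.
Definition capcls (P Q : cls) : cls := fun x => (P x ∧ Q x)%fml.
Definition setcls (X : svar) : cls := fun x => (x ∈ X)%fml.

(** [app f x y] : [f(x) = y], where functions are sets of pairs. *)
Definition app (f : svar) (x y : expr) : fml := (⟨x, y⟩ ∈ f)%fml.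

Definition func (f : svar) (P Q : cls) : fml :=
  ((∀₁ z, z ∈ f → ∃₁ x y, P x ∧ Q y ∧ z = ⟨x, y⟩)
   ∧ (∀₁ x, P x → ∃₁ y, app f x y)
   ∧ (∀₁ x y y', app f x y → app f x y' → y = y'))%fml.

Definition bijection (f : svar) (P Q : cls) : fml :=
  (func f P Q
   ∧ (∀₁ x x' y, app f x y → app f x' y → x = x')
   ∧ (∀₁ y, Q y → ∃₁ x, app f x y))%fml.

(** [upto k] is [[k] = {j : j <= k}]; [below m] is [[m-1]], empty for [m = 0]. *)
Definition upto (k : expr) : cls := fun j => (j <= k)%fml.
Definition below (m : expr) : cls := fun j => (j < m)%fml.

Definition card_eq (P : cls) (m : expr) : fml := (∃₂ g, bijection g (below m) P)%fml.
Definition card_gt (P : cls) (m : expr) : fml := (∃₁ m', m < m' ∧ card_eq P m')%fml.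

Definition finite (P : cls) : fml := (∃₁ b, ∀₁ x, P x → x < b)%fml.
Definition infinite (P : cls) : fml := (¬ finite P)%fml.

(** * The principles *)

Definition extensional (F : svar) : fml :=
  (∀₁ l l', is_seq l → is_seq l' → eqcls (A_ l) (A_ l') →
     ∃₁ v, app F l v ∧ app F l' v)%fml.

(** A sequence [(l_m)] of elements of Seq is a function [L] with [L(m) = l_m]. *)
Definition nested_with_union (L : svar) : fml :=
  (func L univ is_seq
   ∧ (∀₁ m l l', app L m l → app L (m + 1) l' → subcls (A_ l) (A_ l'))
   ∧ ∃₂ U, ∀₁ x, x ∈ U ↔ ∃₁ m l, app L m l ∧ A_ l x)%fml.

Definition stabilizes (F L : svar) : fml :=
  (∃₁ i, ∀₁ j, i <= j →
     ∃₁ a b v, app L i a ∧ app L j b ∧ app F a v ∧ app F b v)%fml.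

Definition AS (F : svar) : fml :=
  (func F univ univ ∧ extensional F
   ∧ ∀₂ L, nested_with_union L → stabilizes F L)%fml.

Definition weakly_converges (L A : svar) : fml :=
  (∀₂ B, finite (setcls B) →
     ∃₁ i, ∀₁ j, i <= j →
       ∃₁ l, app L j l ∧ eqcls (capcls (A_ l) (setcls B)) (capcls (setcls A) (setcls B)))%fml.

Definition weakly_convergent (L : svar) : fml :=
  (func L univ is_seq ∧ ∃₂ A, infinite (setcls A) ∧ weakly_converges L A)%fml.

Definition ASNIS (F : svar) : fml :=
  (func F univ univ ∧ extensional F
   ∧ ∀₂ L, weakly_convergent L → stabilizes F L)%fml.

Definition fiber (f : svar) (c : expr) : cls := fun x => app f x c.

Definition constant_on (f : svar) (P : cls) : fml :=
  (∀₁ x y, P x → P y → ∃₁ c, app f x c ∧ app f y c)%fml.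

Definition IPP : fml :=
  (∀₁ n, ∀₂ f, func f univ (upto n) → ∃₁ c, c <= n ∧ infinite (fiber f c))%fml.

Definition FIPP2 : fml :=
  (∀₁ n, ∀₂ F, AS F →
     ∃₁ k, ∀₂ f, func f (upto k) (upto n) →
       ∃₁ l, is_seq l ∧ subcls (A_ l) (upto k)
             ∧ (∃₁ v, app F l v ∧ card_gt (A_ l) v)
             ∧ constant_on f (A_ l))%fml.

Definition FIPP3 : fml :=
  (∀₁ n, ∀₂ F, ASNIS F →
     ∃₁ k, ∀₂ f, func f (upto k) (upto n) →
       ∃₁ l c, is_seq l ∧ c <= n
               ∧ eqcls (A_ l) (fiber f c)
               ∧ ∃₁ v, app F l v ∧ card_gt (A_ l) v)%fml.

(* Main.v *)
(** The calculus is complete for term-generated two-sorted models, so it suffices to argue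
    inside an arbitrary model of RCA0.

    There, let [f] be a coloring all of whose fibers are bounded.  Let [F(l) = 0] if [f] is not
    constant on [A_l]; otherwise let [F(l)] be the least number that is divisible by suitable
    pairwise coprime moduli, one for each number up to an element of [A_l].  On an
    [f]-homogeneous [l] this exceeds [|A_l|] and depends only on the largest element of [A_l].
    A nested sequence with union either contains an inhomogeneous set, from which point on
    [F] is [0], or its union lies in one fiber and has a largest element, from whose appearance
    on [F] is constant.  An infinite set is not homogeneous, so along a weakly convergent
    sequence [F] is eventually [0].  Hence [F] is in both AS and ASNIS, but it admits no [k] for
    [FIPP2] or [FIPP3], as the restriction of [f] to [[k]] shows. *)

From Stdlib Require Import List Arith Lia Cantor ClassicalEpsilon
  FunctionalExtensionality PropExtensionality ProofIrrelevance.
Require Import Defs.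
Import ListNotations.

(** * Substitution *)

(** The obvious value, one more than the largest element of [A_l], would call for the full
    pigeonhole principle for a bijection given as a set, whose usual proof alters the function at
    every step. Coprime moduli give a weaker bound at a lower price: along an injection into the
    range, the moduli of the successive images multiply up to a divisor of the value, so one Sigma01
    induction with a numerical witness suffices, and no sequence code is ever constructed. Moduli
    are attached to all numbers up to an element of [A_l], not only to its elements, so that the
    value does not move while the set grows below its maximum. Comprehension is applied to bounded
    formulas only. The notions entering the definition of [F] are therefore recast with bounded
    quantifiers, which is possible because a code exceeds everything that it codes. Models are
    term-generated so that arbitrary elements and sets can serve as parameters of the schemes under
    one fixed assignment. *)

Definition scons {A : Type} (x : A) (v : nat -> A) (i : nat) : A :=
  match i with 0 => x | S i => v i end.

Lemma tsubst_comp s s' t :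
  tsubst s (tsubst s' t) = tsubst (fun i => tsubst s (s' i)) t.
Proof. induction t; cbn; congruence. Qed.

Lemma tsubst_id t : tsubst Var t = t.
Proof. induction t; cbn; congruence. Qed.

Lemma up1_comp s s' :
  (fun i => tsubst (up1 s) (up1 s' i)) = up1 (fun i => tsubst s (s' i)).
Proof.
  extensionality i; destruct i; [reflexivity|].
  cbn; unfold tshift; now rewrite !tsubst_comp.
Qed.

Lemma up2_comp r r' :
  (fun i => up2 r (up2 r' i)) = up2 (fun i => r (r' i)).
Proof. extensionality i; now destruct i. Qed.

Lemma up1_id : up1 Var = Var.
Proof. extensionality i; now destruct i. Qed.

Lemma up2_id : up2 (fun X => X) = (fun X => X).
Proof. extensionality i; now destruct i. Qed.

Lemma subst_comp p : forall s r s' r',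
  subst s r (subst s' r' p) = subst (fun i => tsubst s (s' i)) (fun X => r (r' X)) p.
Proof.
  induction p as [| | | |? H ? H'|? H ? H'|? H ? H'|? H|? H|? H|? H]; intros; cbn;
    rewrite ?tsubst_comp, ?H, ?up1_comp, ?up2_comp; try rewrite H'; reflexivity.
Qed.

Lemma subst_id p : subst Var (fun X => X) p = p.
Proof.
  induction p; cbn; rewrite ?tsubst_id, ?up1_id, ?up2_id; congruence.
Qed.

Lemma subst_inst1 s r t p :
  subst s r (inst1 t p) = inst1 (tsubst s t) (subst (up1 s) r p).
Proof.
  unfold inst1; rewrite !subst_comp; f_equal.
  extensionality i; destruct i; cbn; [reflexivity|].
  unfold tshift; rewrite tsubst_comp; symmetry; apply tsubst_id.
Qed.

Lemma subst_inst2 s r Y p :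
  subst s r (inst2 Y p) = inst2 (r Y) (subst s (up2 r) p).
Proof.
  unfold inst2; rewrite !subst_comp; f_equal.
  - extensionality i; cbn; symmetry; apply tsubst_id.
  - extensionality i; now destruct i.
Qed.

Lemma subst_shift1 s r p : subst (up1 s) r (shift1 p) = shift1 (subst s r p).
Proof. unfold shift1; now rewrite !subst_comp. Qed.

Lemma subst_shift2 s r p : subst s (up2 r) (shift2 p) = shift2 (subst s r p).
Proof.
  unfold shift2; rewrite !subst_comp; f_equal.
  extensionality i; cbn; symmetry; apply tsubst_id.
Qed.

Lemma inst1_up1 t s r p : inst1 t (subst (up1 s) r p) = subst (scons t s) r p.
Proof.
  unfold inst1; rewrite subst_comp; f_equal.
  extensionality i; destruct i; cbn; [reflexivity|].
  unfold tshift; rewrite tsubst_comp; apply tsubst_id.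
Qed.

Lemma inst2_up2 Y s r p : inst2 Y (subst s (up2 r) p) = subst s (scons Y r) p.
Proof.
  unfold inst2; rewrite subst_comp; f_equal.
  - extensionality i; apply tsubst_id.
  - extensionality i; now destruct i.
Qed.

Lemma tsubst_fresh t :
  exists N, forall s s', (forall i, i < N -> s i = s' i) -> tsubst s t = tsubst s' t.
Proof.
  induction t as [i| | |t [N HN] u [N' HN']|t [N HN] u [N' HN']];
    [exists (S i); cbn; auto|exists 0; auto|exists 0; auto| |];
    exists (N + N'); intros s s' Hs; cbn; f_equal; [apply HN|apply HN'|apply HN|apply HN'];
    intros; apply Hs; lia.
Qed.

Definition agree {A : Type} (N : nat) (s s' : nat -> A) : Prop :=
  forall i, i < N -> s i = s' i.

(** All free variables of [p], of both sorts, are below [N]. *)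
Definition fresh_from (N : nat) (p : form) : Prop :=
  forall s s' r r', agree N s s' -> agree N r r' -> subst s r p = subst s' r' p.

Lemma fresh_from_le N N' p : fresh_from N p -> N <= N' -> fresh_from N' p.
Proof.
  intros H HN s s' r r' Hs Hr; apply H; intros i Hi; [apply Hs|apply Hr]; lia.
Qed.

Lemma fresh_from_exists p : exists N, fresh_from N p.
Proof.
  assert (B : forall q q' N N', fresh_from N q -> fresh_from N' q' ->
    fresh_from (N + N') q /\ fresh_from (N + N') q').
  { intros q q' N N' H H'; split; eapply fresh_from_le; try eassumption; lia. }
  assert (U1 : forall N s s', agree N s s' -> agree N (up1 s) (up1 s')).
  { intros N s s' H [|i] Hi; cbn; [reflexivity|]; rewrite H; [reflexivity|lia]. }
  assert (U2 : forall N s s', agree N s s' -> agree N (up2 s) (up2 s')).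
  { intros N s s' H [|i] Hi; cbn; [reflexivity|]; rewrite H; [reflexivity|lia]. }
  induction p as [|t u|t u|t X|p [N H] q [N' H']|p [N H] q [N' H']|p [N H] q [N' H']
    |p [N H]|p [N H]|p [N H]|p [N H]].
  - exists 0; intros s s' r r' _ _; reflexivity.
  - destruct (tsubst_fresh t) as [N H], (tsubst_fresh u) as [N' H'].
    exists (N + N'); intros s s' r r' Hs Hr; cbn.
    f_equal; [apply H|apply H']; intros; apply Hs; lia.
  - destruct (tsubst_fresh t) as [N H], (tsubst_fresh u) as [N' H'].
    exists (N + N'); intros s s' r r' Hs Hr; cbn.
    f_equal; [apply H|apply H']; intros; apply Hs; lia.
  - destruct (tsubst_fresh t) as [N H].
    exists (N + S X); intros s s' r r' Hs Hr; cbn.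
    f_equal; [apply H; intros; apply Hs|apply Hr]; lia.
  - destruct (B _ _ _ _ H H'); exists (N + N'); intros s s' r r' Hs Hr; cbn; f_equal; auto.
  - destruct (B _ _ _ _ H H'); exists (N + N'); intros s s' r r' Hs Hr; cbn; f_equal; auto.
  - destruct (B _ _ _ _ H H'); exists (N + N'); intros s s' r r' Hs Hr; cbn; f_equal; auto.
  - exists N; intros s s' r r' Hs Hr; cbn; f_equal; auto.
  - exists N; intros s s' r r' Hs Hr; cbn; f_equal; auto.
  - exists N; intros s s' r r' Hs Hr; cbn; f_equal; auto.
  - exists N; intros s s' r r' Hs Hr; cbn; f_equal; auto.
Qed.

Lemma fresh_from_list G : exists N, Forall (fresh_from N) G.
Proof.
  induction G as [|p G [N HN]]; [exists 0; constructor|].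
  destruct (fresh_from_exists p) as [N' H'].
  exists (N + N'); constructor; [eapply fresh_from_le; [eassumption|lia]|].
  eapply Forall_impl; [|exact HN]; intros q Hq; eapply fresh_from_le; [eassumption|lia].
Qed.

(** * Derivations *)

Lemma prv_weaken T G p : prv T G p -> forall G', incl G G' -> prv T G' p.
Proof.
  induction 1; intros G' HG;
    try (econstructor; eauto using incl_map; fail).
  - eapply prv_impI, IHprv, incl_cons; [left; reflexivity|now apply incl_tl].
  - eapply prv_raa, IHprv, incl_cons; [left; reflexivity|now apply incl_tl].
  - eapply prv_orE; [eauto|apply IHprv2|apply IHprv3];
      (apply incl_cons; [left; reflexivity|now apply incl_tl]).
  - eapply prv_ex1E; [eauto|apply IHprv2].
    apply incl_cons; [left; reflexivity|now apply incl_tl, incl_map].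
  - eapply prv_ex2E; [eauto|apply IHprv2].
    apply incl_cons; [left; reflexivity|now apply incl_tl, incl_map].
Qed.

Definition subst_closed (T : form -> Prop) : Prop :=
  forall p s r, T p -> T (subst s r p).

Lemma map_subst_shift1 s r G :
  map (subst (up1 s) r) (map shift1 G) = map shift1 (map (subst s r) G).
Proof. rewrite !map_map; apply map_ext; intros; apply subst_shift1. Qed.

Lemma map_subst_shift2 s r G :
  map (subst s (up2 r)) (map shift2 G) = map shift2 (map (subst s r) G).
Proof. rewrite !map_map; apply map_ext; intros; apply subst_shift2. Qed.

(** Needed to rename a fresh free variable into the bound variable that the quantifier rules speak
    of. The eigenvariable rules go through because substitution commutes with shifting. *)
Lemma prv_subst T : subst_closed T -> forall G p, prv T G p ->
  forall s r, prv T (map (subst s r) G) (subst s r p).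
Proof.
  intros HT; induction 1; intros s e.
  - apply prv_ax; auto.
  - apply prv_hyp; now apply in_map.
  - apply prv_impI; apply IHprv.
  - eapply prv_impE; [apply IHprv1|apply IHprv2].
  - apply prv_raa; apply IHprv.
  - apply prv_andI; [apply IHprv1|apply IHprv2].
  - eapply prv_andE1; apply IHprv.
  - eapply prv_andE2; apply IHprv.
  - apply prv_orI1; apply IHprv.
  - apply prv_orI2; apply IHprv.
  - eapply prv_orE; [apply IHprv1|apply IHprv2|apply IHprv3].
  - apply prv_all1I; rewrite <- map_subst_shift1; apply IHprv.
  - rewrite subst_inst1; apply prv_all1E; apply IHprv.
  - apply prv_ex1I with (tsubst s t); rewrite <- subst_inst1; apply IHprv.
  - eapply prv_ex1E; [apply IHprv1|].
    rewrite <- map_subst_shift1, <- subst_shift1; apply IHprv2.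
  - apply prv_all2I; rewrite <- map_subst_shift2; apply IHprv.
  - rewrite subst_inst2; apply prv_all2E; apply IHprv.
  - apply prv_ex2I with (e Y); rewrite <- subst_inst2; apply IHprv.
  - eapply prv_ex2E; [apply IHprv1|].
    rewrite <- map_subst_shift2, <- subst_shift2; apply IHprv2.
  - apply prv_eq_refl.
  - rewrite subst_inst1; eapply prv_eq_subst; [apply IHprv1|].
    rewrite <- subst_inst1; apply IHprv2.
Qed.

Lemma prv_contra T G p q : prv T G p -> prv T G (Neg p) -> prv T G q.
Proof.
  intros H H'; apply prv_raa.
  eapply prv_impE; (eapply prv_weaken; [eassumption|apply incl_tl, incl_refl]).
Qed.

Lemma map_subst_fresh N G s s' r r' :
  Forall (fresh_from N) G -> agree N s s' -> agree N r r' ->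
  map (subst s r) G = map (subst s' r') G.
Proof.
  intros HG Hs Hr; apply map_ext_in; intros p Hp.
  rewrite Forall_forall in HG; now apply HG.
Qed.

Lemma prv_witness1 T N G p : subst_closed T ->
  fresh_from N p -> Forall (fresh_from N) G ->
  prv T (inst1 (Var N) p :: G) Bot -> prv T (Ex1 p :: G) Bot.
Proof.
  intros HT Hp HG H.
  eapply prv_ex1E; [apply prv_hyp; left; reflexivity|].
  (* This renaming sends the fresh [N] back to index 0 and shifts everything else: it undoes the
     instantiation of [p] and acts as [shift1] on [G]. *)
  pose (s := fun i => if i =? N then Var 0 else Var (S i)).
  apply (prv_subst T HT) with (s := s) (r := fun X => X) in H; cbn in H.
  assert (Ep : subst s (fun X => X) (inst1 (Var N) p) = p).
  { unfold inst1; rewrite subst_comp; transitivity (subst Var (fun X => X) p);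
      [apply Hp; [|intros i _; reflexivity]|apply subst_id].
    intros i Hi; destruct i; cbn; unfold s.
    - now rewrite Nat.eqb_refl.
    - destruct (Nat.eqb_spec i N); [lia|reflexivity]. }
  rewrite Ep in H.
  eapply prv_weaken; [exact H|].
  apply incl_cons; [left; reflexivity|]; cbn.
  apply incl_tl, incl_tl.
  rewrite (map_subst_fresh N G s (fun i => Var (S i)) (fun X => X) (fun X => X));
    [apply incl_refl|exact HG| |intros i _; reflexivity].
  intros i Hi; unfold s; destruct (Nat.eqb_spec i N); [lia|reflexivity].
Qed.

Lemma prv_witness2 T N G p : subst_closed T ->
  fresh_from N p -> Forall (fresh_from N) G ->
  prv T (inst2 N p :: G) Bot -> prv T (Ex2 p :: G) Bot.
Proof.
  intros HT Hp HG H.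
  eapply prv_ex2E; [apply prv_hyp; left; reflexivity|].
  pose (r := fun i => if i =? N then 0 else S i).
  apply (prv_subst T HT) with (s := Var) (r := r) in H; cbn in H.
  assert (Ep : subst Var r (inst2 N p) = p).
  { unfold inst2; rewrite subst_comp; transitivity (subst Var (fun X => X) p);
      [apply Hp; [intros i _; reflexivity|]|apply subst_id].
    intros i Hi; destruct i; cbn; unfold r.
    - now rewrite Nat.eqb_refl.
    - destruct (Nat.eqb_spec i N); [lia|reflexivity]. }
  rewrite Ep in H.
  eapply prv_weaken; [exact H|].
  apply incl_cons; [left; reflexivity|]; cbn.
  apply incl_tl, incl_tl.
  rewrite (map_subst_fresh N G Var Var r S);
    [apply incl_refl|exact HG|intros i _; reflexivity|].
  intros i Hi; unfold r; destruct (Nat.eqb_spec i N); [lia|reflexivity].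
Qed.

(** * Two-sorted models *)

Record model : Type := {
  num : Type;
  sets : Type;
  mzero : num;
  mone : num;
  madd : num -> num -> num;
  mmul : num -> num -> num;
  mlt : num -> num -> Prop;
  mmem : num -> sets -> Prop }.

Fixpoint eval (M : model) (v : nat -> num M) (t : term) : num M :=
  match t with
  | Var i => v i
  | Zero => mzero M
  | One => mone M
  | Plus t u => madd M (eval M v t) (eval M v u)
  | Times t u => mmul M (eval M v t) (eval M v u)
  end.

Fixpoint sat (M : model) (v : nat -> num M) (e : nat -> sets M) (p : form) : Prop :=
  match p with
  | Bot => False
  | Eq t u => eval M v t = eval M v u
  | Lt t u => mlt M (eval M v t) (eval M v u)
  | Mem t X => mmem M (eval M v t) (e X)
  | Imp p q => sat M v e p -> sat M v e q
  | And p q => sat M v e p /\ sat M v e q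
  | Or p q => sat M v e p \/ sat M v e q
  | All1 p => forall x, sat M (scons x v) e p
  | Ex1 p => exists x, sat M (scons x v) e p
  | All2 p => forall X, sat M v (scons X e) p
  | Ex2 p => exists X, sat M v (scons X e) p
  end.

Lemma eval_tsubst M v s t : eval M v (tsubst s t) = eval M (fun i => eval M v (s i)) t.
Proof. induction t; cbn; congruence. Qed.

Lemma eval_up1 M v s x :
  (fun i => eval M (scons x v) (up1 s i)) = scons x (fun i => eval M v (s i)).
Proof.
  extensionality i; destruct i; cbn; [reflexivity|].
  unfold tshift; now rewrite eval_tsubst.
Qed.

Lemma scons_up2 {A : Type} (e : nat -> A) r X :
  (fun i => scons X e (up2 r i)) = scons X (fun i => e (r i)).
Proof. extensionality i; now destruct i. Qed.

Lemma sat_subst M p : forall v e s r,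
  sat M v e (subst s r p) <-> sat M (fun i => eval M v (s i)) (fun X => e (r X)) p.
Proof.
  induction p; intros; cbn; rewrite ?eval_tsubst; try reflexivity.
  1,2,3: now rewrite IHp1, IHp2.
  - split; intros H x; specialize (H x); rewrite ?IHp, ?eval_up1 in *; exact H.
  - split; intros [x H]; exists x; rewrite ?IHp, ?eval_up1 in *; exact H.
  - split; intros H x; specialize (H x); rewrite ?IHp, ?scons_up2 in *; exact H.
  - split; intros [x H]; exists x; rewrite ?IHp, ?scons_up2 in *; exact H.
Qed.

(** * Completeness *)

Local Notation pair_code a b := (to_nat (a, b)).
Arguments to_nat : simpl never.

Fixpoint term_code (t : term) : nat :=
  match t with
  | Var i => pair_code 0 i
  | Zero => pair_code 1 0
  | One => pair_code 2 0
  | Plus t u => pair_code 3 (pair_code (term_code t) (term_code u))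
  | Times t u => pair_code 4 (pair_code (term_code t) (term_code u))
  end.

(** Only injectivity matters: stage [n] of the chain below treats the formula with code [n], if
    there is one. *)
Fixpoint form_code (p : form) : nat :=
  match p with
  | Bot => pair_code 0 0
  | Eq t u => pair_code 1 (pair_code (term_code t) (term_code u))
  | Lt t u => pair_code 2 (pair_code (term_code t) (term_code u))
  | Mem t X => pair_code 3 (pair_code (term_code t) X)
  | Imp p q => pair_code 4 (pair_code (form_code p) (form_code q))
  | And p q => pair_code 5 (pair_code (form_code p) (form_code q))
  | Or p q => pair_code 6 (pair_code (form_code p) (form_code q))
  | All1 p => pair_code 7 (form_code p)
  | Ex1 p => pair_code 8 (form_code p)
  | All2 p => pair_code 9 (form_code p)
  | Ex2 p => pair_code 10 (form_code p)
  end.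

Lemma pair_code_inj a b c d : pair_code a b = pair_code c d -> a = c /\ b = d.
Proof. intros E; apply to_nat_inj in E; now injection E. Qed.

Ltac split_codes :=
  repeat match goal with
  | E : pair_code _ _ = pair_code _ _ |- _ =>
      apply pair_code_inj in E; destruct E; try discriminate
  end.

Lemma term_code_inj t : forall u, term_code t = term_code u -> t = u.
Proof.
  induction t; intros [] E; cbn in E; split_codes; f_equal; auto.
Qed.

Lemma form_code_inj p : forall q, form_code p = form_code q -> p = q.
Proof.
  induction p; intros [] E; cbn in E; split_codes; f_equal; auto using term_code_inj.
Qed.

(** * The Henkin chain and its truth conditions *)

Section Henkin.

Variables (T : form -> Prop) (G0 : list form).
Hypothesis (HT : subst_closed T) (HG0 : ~ prv T G0 Bot).

(** A formula that is not existential is its own witness, so that the chain can treat all formulas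
    alike. *)
Definition witness (p : form) (N : nat) : form :=
  match p with
  | Ex1 q => inst1 (Var N) q
  | Ex2 q => inst2 N q
  | p => p
  end.

Lemma prv_witness p G :
  ~ prv T (p :: G) Bot -> exists N, ~ prv T (witness p N :: p :: G) Bot.
Proof.
  intros H.
  destruct p as [| | | | | | | |p| |p];
    try (exists 0; intros H'; apply H; eapply prv_weaken;
      [exact H'|apply incl_cons; [left; reflexivity|apply incl_refl]]).
  - destruct (fresh_from_list (p :: Ex1 p :: G)) as [N HN]; inversion HN; subst.
    exists N; intros H'; apply H; cbn in H'.
    eapply prv_weaken; [eapply prv_witness1; eassumption|].
    apply incl_cons; [left; reflexivity|apply incl_refl].
  - destruct (fresh_from_list (p :: Ex2 p :: G)) as [N HN]; inversion HN; subst.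
    exists N; intros H'; apply H; cbn in H'.
    eapply prv_weaken; [eapply prv_witness2; eassumption|].
    apply incl_cons; [left; reflexivity|apply incl_refl].
Qed.

(** The last clause does two jobs at once: it decides the formula with code [n], and it supplies a
    named instance if that formula is accepted. *)
Definition henkin_step (n : nat) (G G' : list form) : Prop :=
  incl G G' /\ ~ prv T G' Bot /\
  forall p, form_code p = n ->
    prv T (p :: G) Bot \/ exists N, In p G' /\ In (witness p N) G'.

Lemma henkin_step_exists n G : ~ prv T G Bot -> exists G', henkin_step n G G'.
Proof.
  intros HG.
  destruct (classic (exists p, form_code p = n /\ ~ prv T (p :: G) Bot))
    as [(p & Ep & Hp)|Hno].
  - destruct (prv_witness _ _ Hp) as [N HN].
    exists (witness p N :: p :: G); split; [|split; [exact HN|]].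
    + apply incl_tl, incl_tl, incl_refl.
    + intros q Eq; rewrite <- Ep in Eq; apply form_code_inj in Eq; subst q.
      right; exists N; cbn; auto.
  - exists G; split; [apply incl_refl|split; [exact HG|]].
    intros p Ep; left; apply NNPP; intros H; apply Hno; eauto.
Qed.

Fixpoint chain (n : nat) : {G | ~ prv T G Bot} :=
  match n with
  | 0 => exist _ G0 HG0
  | S n =>
      let G' := constructive_indefinite_description _
        (henkin_step_exists n _ (proj2_sig (chain n))) in
      exist _ (proj1_sig G') (proj1 (proj2 (proj2_sig G')))
  end.

Lemma chain_step n : henkin_step n (proj1_sig (chain n)) (proj1_sig (chain (S n))).
Proof. cbn; destruct constructive_indefinite_description as [G' HG']; exact HG'. Qed.

Lemma chain_mono n m : n <= m -> incl (proj1_sig (chain n)) (proj1_sig (chain m)).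
Proof.
  induction 1; [apply incl_refl|].
  eapply incl_tran; [eassumption|apply (chain_step m)].
Qed.

(** Derivability from a stage rather than membership in one: closure under the rules then follows by
    weakening to a common stage. *)
Definition thm (p : form) : Prop := exists n, prv T (proj1_sig (chain n)) p.

Lemma thm_mono n p : prv T (proj1_sig (chain n)) p ->
  forall m, n <= m -> prv T (proj1_sig (chain m)) p.
Proof. intros H m Hm; eapply prv_weaken; [exact H|now apply chain_mono]. Qed.

Lemma thm1 p q : (forall G, prv T G p -> prv T G q) -> thm p -> thm q.
Proof. intros H [n Hn]; exists n; auto. Qed.

Lemma thm2 p q r :
  (forall G, prv T G p -> prv T G q -> prv T G r) -> thm p -> thm q -> thm r.
Proof.
  intros H [n Hn] [m Hm]; exists (n + m).
  apply H; eapply thm_mono; try eassumption; lia.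
Qed.

Lemma thm_consistent : ~ thm Bot.
Proof. intros [n Hn]; exact (proj2_sig (chain n) Hn). Qed.

Lemma thm_neg p : thm (Neg p) <-> ~ thm p.
Proof.
  split.
  - intros H H'; apply thm_consistent; revert H H'; apply thm2; intros G; apply prv_impE.
  (* Stage [form_code p] either refutes [p] or puts it into the next stage. *)
  - intros H; destruct (chain_step (form_code p)) as (_ & _ & Hp).
    destruct (Hp p eq_refl) as [H'|(N & H' & _)].
    + exists (form_code p); now apply prv_impI.
    + exfalso; apply H; exists (S (form_code p)); now apply prv_hyp.
Qed.

Lemma thm_witness p : thm p -> exists N, thm (witness p N).
Proof.
  intros H; destruct (chain_step (form_code p)) as (_ & _ & Hp).
  destruct (Hp p eq_refl) as [H'|(N & _ & H')].
  - assert (Hn : thm (Neg p)) by (exists (form_code p); now apply prv_impI).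
    now apply thm_neg in Hn.
  - exists N, (S (form_code p)); now apply prv_hyp.
Qed.

Lemma thm_imp p q : thm (Imp p q) <-> (thm p -> thm q).
Proof.
  split.
  - apply thm2; intros G; apply prv_impE.
  - intros H; apply NNPP; intros Hn.
    assert (Hp : thm p).
    { apply NNPP; intros Hp; apply Hn; apply thm_neg in Hp; revert Hp; apply thm1.
      intros G H1; apply prv_impI; eapply prv_contra; [apply prv_hyp; left; reflexivity|].
      eapply prv_weaken; [exact H1|apply incl_tl, incl_refl]. }
    apply Hn; generalize (H Hp); apply thm1; intros G H1; apply prv_impI.
    eapply prv_weaken; [exact H1|apply incl_tl, incl_refl].
Qed.

Lemma thm_and p q : thm (And p q) <-> thm p /\ thm q.
Proof.
  split.
  - intros H; split; revert H; apply thm1; intros G; [apply prv_andE1|apply prv_andE2].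
  - intros [H H']; revert H H'; apply thm2; intros G; apply prv_andI.
Qed.

Lemma thm_or p q : thm (Or p q) <-> thm p \/ thm q.
Proof.
  split.
  - intros H; apply NNPP; intros Hn; apply not_or_and in Hn; destruct Hn as [Hp Hq].
    apply thm_neg in Hp, Hq; apply thm_consistent.
    assert (Hpq : thm (And (Neg p) (Neg q))) by now apply thm_and.
    revert H Hpq; apply thm2; intros G H1 H2; eapply prv_orE; [exact H1| |].
    + eapply prv_impE; [|apply prv_hyp; left; reflexivity].
      eapply prv_andE1, prv_weaken; [exact H2|apply incl_tl, incl_refl].
    + eapply prv_impE; [|apply prv_hyp; left; reflexivity].
      eapply prv_andE2, prv_weaken; [exact H2|apply incl_tl, incl_refl].
  - intros [H|H]; revert H; apply thm1; intros G; [apply prv_orI1|apply prv_orI2].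
Qed.

Lemma thm_ex1 p : thm (Ex1 p) <-> exists t, thm (inst1 t p).
Proof.
  split.
  - intros H; destruct (thm_witness _ H) as [N HN]; exists (Var N); exact HN.
  - intros [t H]; revert H; apply thm1; intros G; apply prv_ex1I.
Qed.

Lemma thm_ex2 p : thm (Ex2 p) <-> exists Y, thm (inst2 Y p).
Proof.
  split.
  - intros H; destruct (thm_witness _ H) as [N HN]; exists N; exact HN.
  - intros [t H]; revert H; apply thm1; intros G; apply prv_ex2I.
Qed.

Lemma inst1_shift1 p : inst1 (Var 0) (subst (up1 (fun i => Var (S i))) (fun X => X) p) = p.
Proof.
  rewrite inst1_up1; transitivity (subst Var (fun X => X) p); [|apply subst_id].
  f_equal; extensionality i; now destruct i.
Qed.

Lemma inst2_shift2 p : inst2 0 (subst Var (up2 S) p) = p.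
Proof.
  rewrite inst2_up2; transitivity (subst Var (fun X => X) p); [|apply subst_id].
  f_equal; extensionality i; now destruct i.
Qed.

Lemma prv_not_all1 G p : prv T G (Neg (All1 p)) -> prv T G (Ex1 (Neg p)).
Proof.
  intros H; apply prv_raa.
  eapply prv_impE; [eapply prv_weaken; [exact H|apply incl_tl, incl_refl]|].
  apply prv_all1I; cbn; apply prv_raa.
  eapply prv_impE; [apply prv_hyp; right; left; reflexivity|].
  apply prv_ex1I with (Var 0).
  change (Imp (subst (up1 (fun i => Var (S i))) (fun X => X) p) Bot)
    with (subst (up1 (fun i => Var (S i))) (fun X => X) (Neg p)).
  rewrite inst1_shift1; apply prv_hyp; left; reflexivity.
Qed.

Lemma prv_not_all2 G p : prv T G (Neg (All2 p)) -> prv T G (Ex2 (Neg p)).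
Proof.
  intros H; apply prv_raa.
  eapply prv_impE; [eapply prv_weaken; [exact H|apply incl_tl, incl_refl]|].
  apply prv_all2I; cbn; apply prv_raa.
  eapply prv_impE; [apply prv_hyp; right; left; reflexivity|].
  apply prv_ex2I with 0.
  change (Imp (subst Var (up2 S) p) Bot) with (subst Var (up2 S) (Neg p)).
  rewrite inst2_shift2; apply prv_hyp; left; reflexivity.
Qed.

(** If the universal formula failed, the chain would contain a counterexample: its negation yields
    an existential formula, which has been given a witness. *)
Lemma thm_all1 p : thm (All1 p) <-> forall t, thm (inst1 t p).
Proof.
  split.
  - intros H t; revert H; apply thm1; intros G; apply prv_all1E.
  - intros H; apply NNPP; intros Hn; apply thm_neg in Hn.
    apply (thm1 _ (Ex1 (Neg p))) in Hn; [|intros G; apply prv_not_all1].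
    apply thm_ex1 in Hn; destruct Hn as [t Ht].
    apply (thm_neg (inst1 t p)) in Ht; auto.
Qed.

Lemma thm_all2 p : thm (All2 p) <-> forall Y, thm (inst2 Y p).
Proof.
  split.
  - intros H t; revert H; apply thm1; intros G; apply prv_all2E.
  - intros H; apply NNPP; intros Hn; apply thm_neg in Hn.
    apply (thm1 _ (Ex2 (Neg p))) in Hn; [|intros G; apply prv_not_all2].
    apply thm_ex2 in Hn; destruct Hn as [t Ht].
    apply (thm_neg (inst2 t p)) in Ht; auto.
Qed.

Lemma thm_ax p : T p -> thm p.
Proof. intros H; exists 0; now apply prv_ax. Qed.

Lemma thm_hyp p : In p G0 -> thm p.
Proof. intros H; exists 0; now apply prv_hyp. Qed.

(** * The model of terms modulo provable equality *)

Definition eqv (t u : term) : Prop := thm (Eq t u).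

Lemma thm_eq_subst p t u : eqv t u -> thm (inst1 t p) -> thm (inst1 u p).
Proof. apply thm2; intros G; apply prv_eq_subst. Qed.

Lemma inst1_tshift t u : tsubst (fun i => match i with 0 => t | S i => Var i end) (tshift u) = u.
Proof. unfold tshift; rewrite tsubst_comp; apply tsubst_id. Qed.

Lemma eqv_refl t : eqv t t.
Proof. exists 0; apply prv_eq_refl. Qed.

Lemma eqv_sym t u : eqv t u -> eqv u t.
Proof.
  intros H; generalize (thm_eq_subst (Eq (Var 0) (tshift t)) _ _ H).
  unfold inst1; cbn; rewrite !inst1_tshift; intros K; apply K, eqv_refl.
Qed.

Lemma eqv_trans t u w : eqv t u -> eqv u w -> eqv t w.
Proof.
  intros H H'; generalize (thm_eq_subst (Eq (tshift t) (Var 0)) _ _ H').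
  unfold inst1; cbn; rewrite !inst1_tshift; intros K; apply K, H.
Qed.

Lemma eqv_class t u : eqv t = eqv u <-> eqv t u.
Proof.
  split.
  - intros E; rewrite E; apply eqv_refl.
  - intros H; extensionality w; apply propositional_extensionality; split.
    + apply eqv_trans, eqv_sym, H.
    + apply eqv_trans, H.
Qed.

(** Classes are represented by predicates, so that equality of the model is equality in Rocq, as
    [sat] interprets [Eq]. *)
Definition tclass : Type := {P : term -> Prop | exists t, P = eqv t}.

Definition cl (t : term) : tclass := exist _ (eqv t) (ex_intro _ t eq_refl).

Definition rep (d : tclass) : term :=
  proj1_sig (constructive_indefinite_description _ (proj2_sig d)).

Lemma cl_eq t u : cl t = cl u <-> eqv t u.
Proof.
  rewrite <- eqv_class; split.
  - intros E; exact (f_equal (@proj1_sig _ _) E).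
  - intros E; unfold cl; apply subset_eq_compat, E.
Qed.

Lemma cl_rep d : cl (rep d) = d.
Proof.
  unfold rep; destruct constructive_indefinite_description as [t Ht]; cbn.
  destruct d as [P HP]; cbn in Ht; apply subset_eq_compat; now symmetry.
Qed.

Lemma rep_cl t : eqv (rep (cl t)) t.
Proof. apply cl_eq, cl_rep. Qed.

(** The language has no equality between sets, so the set variables themselves serve as sets; only
    the number sort is factored. *)
Definition term_model : model := {|
  num := tclass;
  sets := nat;
  mzero := cl Zero;
  mone := cl One;
  madd := fun d d' => cl (Plus (rep d) (rep d'));
  mmul := fun d d' => cl (Times (rep d) (rep d'));
  mlt := fun d d' => thm (Lt (rep d) (rep d'));
  mmem := fun d X => thm (Mem (rep d) X) |}.

Lemma eqv_plus t t' u u' : eqv t t' -> eqv u u' -> eqv (Plus t u) (Plus t' u').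
Proof.
  intros H H'; apply eqv_trans with (Plus t' u).
  - generalize (thm_eq_subst (Eq (Plus (tshift t) (tshift u)) (Plus (Var 0) (tshift u))) _ _ H).
    unfold inst1; cbn; rewrite !inst1_tshift; intros K; apply K, eqv_refl.
  - generalize (thm_eq_subst (Eq (Plus (tshift t') (tshift u)) (Plus (tshift t') (Var 0))) _ _ H').
    unfold inst1; cbn; rewrite !inst1_tshift; intros K; apply K, eqv_refl.
Qed.

Lemma eqv_times t t' u u' : eqv t t' -> eqv u u' -> eqv (Times t u) (Times t' u').
Proof.
  intros H H'; apply eqv_trans with (Times t' u).
  - generalize (thm_eq_subst (Eq (Times (tshift t) (tshift u)) (Times (Var 0) (tshift u))) _ _ H).
    unfold inst1; cbn; rewrite !inst1_tshift; intros K; apply K, eqv_refl.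
  - generalize (thm_eq_subst (Eq (Times (tshift t') (tshift u)) (Times (tshift t') (Var 0))) _ _ H').
    unfold inst1; cbn; rewrite !inst1_tshift; intros K; apply K, eqv_refl.
Qed.

Lemma thm_lt_eqv t t' u u' : eqv t t' -> eqv u u' -> thm (Lt t u) -> thm (Lt t' u').
Proof.
  intros H H' K.
  generalize (thm_eq_subst (Lt (Var 0) (tshift u)) _ _ H).
  generalize (thm_eq_subst (Lt (tshift t') (Var 0)) _ _ H').
  unfold inst1; cbn; rewrite !inst1_tshift; auto.
Qed.

Lemma thm_mem_eqv t t' X : eqv t t' -> thm (Mem t X) -> thm (Mem t' X).
Proof. intros H; exact (thm_eq_subst (Mem (Var 0) X) _ _ H). Qed.

Lemma eval_term_model s t : eval term_model (fun i => cl (s i)) t = cl (tsubst s t).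
Proof.
  induction t; cbn; try reflexivity; rewrite IHt1, IHt2; apply cl_eq;
    [apply eqv_plus|apply eqv_times]; apply rep_cl.
Qed.

Lemma cl_scons t s : scons (cl t) (fun i => cl (s i)) = (fun i => cl (scons t s i)).
Proof. extensionality i; now destruct i. Qed.

(** Every element is the class of a term, so number assignments amount to substitutions; keeping [s]
    and [r] general lets the induction pass under quantifiers. *)
Lemma sat_term_model p : forall s r,
  sat term_model (fun i => cl (s i)) r p <-> thm (subst s r p).
Proof.
  induction p; intros s r; cbn [sat subst]; rewrite ?eval_term_model.
  - split; [tauto|apply thm_consistent].
  - apply cl_eq.
  - cbn; split; apply thm_lt_eqv; try apply rep_cl; apply eqv_sym, rep_cl.
  - cbn; split; apply thm_mem_eqv; [|apply eqv_sym]; apply rep_cl.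
  - now rewrite thm_imp, IHp1, IHp2.
  - now rewrite thm_and, IHp1, IHp2.
  - now rewrite thm_or, IHp1, IHp2.
  - rewrite thm_all1; split.
    + intros H t; rewrite inst1_up1, <- IHp, <- cl_scons; apply H.
    + intros H d; rewrite <- (cl_rep d), cl_scons, IHp, <- inst1_up1; apply H.
  - rewrite thm_ex1; split.
    + intros [d H]; exists (rep d); rewrite inst1_up1, <- IHp, <- cl_scons, cl_rep; exact H.
    + intros [t H]; exists (cl t); rewrite cl_scons, IHp, <- inst1_up1; exact H.
  - rewrite thm_all2; split; intros H Y; specialize (H Y);
      rewrite ?inst2_up2, ?IHp in *; exact H.
  - rewrite thm_ex2; split; intros [Y H]; exists Y;
      rewrite ?inst2_up2, ?IHp in *; exact H.
Qed.

End Henkin.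

(** Every element is named by a term under [v0], so that parameters of definable
    classes can be eliminated in favour of free variables. *)
Definition generated (M : model) (v0 : nat -> num M) (e0 : nat -> sets M) : Prop :=
  (forall d, exists t, eval M v0 t = d) /\ (forall X, exists i, e0 i = X).

Theorem completeness T p :
  subst_closed T ->
  (forall M v0 e0, generated M v0 e0 ->
    (forall q v e, T q -> sat M v e q) -> sat M v0 e0 p) ->
  proves T p.
Proof.
  intros HT Hsem; apply prv_raa, NNPP; intros Hc.
  pose (M := term_model T [Neg p] HT Hc).
  assert (Hp : sat M (fun i => cl T [Neg p] HT Hc (Var i)) (fun X => X) p).
  { apply Hsem.
    - split; [|intros X; exists X; reflexivity].
      intros d; exists (rep T [Neg p] HT Hc d).
      unfold M; rewrite eval_term_model, tsubst_id; apply cl_rep.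
    (* An arbitrary assignment is a substitution by representatives, and the corresponding instance
       of the axiom is again an axiom. *)
    - intros q v e Hq.
      replace v with (fun i => cl T [Neg p] HT Hc (rep T [Neg p] HT Hc (v i)))
        by (extensionality i; apply cl_rep).
      apply sat_term_model, thm_ax, HT, Hq. }
  apply sat_term_model in Hp; rewrite subst_id in Hp; revert Hp.
  apply thm_neg, thm_hyp; left; reflexivity.
Qed.

(** * Models of RCA0 *)

Lemma tsubst_up1_tshift s t : tsubst (up1 s) (tshift t) = tshift (tsubst s t).
Proof. unfold tshift; now rewrite !tsubst_comp. Qed.

Lemma bounded_subst p : bounded p -> forall s r, bounded (subst s r p).
Proof.
  induction 1; intros s e; cbn; try (constructor; auto; fail);
    rewrite tsubst_up1_tshift; constructor; auto.
Qed.

Lemma Sigma01_subst p s r : Sigma01 p -> Sigma01 (subst s r p).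
Proof. intros []; cbn; constructor; now apply bounded_subst. Qed.

Lemma Pi01_subst p s r : Pi01 p -> Pi01 (subst s r p).
Proof. intros []; cbn; constructor; now apply bounded_subst. Qed.

(** The basic axioms are closed, and an instance of a scheme becomes the instance for the formula
    with its parameters substituted. *)
Lemma RCA0_subst_closed : subst_closed RCA0.
Proof.
  intros p s r [q Hq|q Hq|q q' Hq Hq'].
  - apply RCA0_basic; destruct Hq; cbn; constructor.
  - assert (E : subst s r (induction q) = induction (subst (up1 s) r q)).
    { unfold induction; cbn; rewrite subst_inst1, !subst_comp; cbn.
      do 5 f_equal; extensionality i; destruct i; cbn; [reflexivity|].
      unfold tshift; now rewrite tsubst_comp. }
    rewrite E; apply RCA0_induction; now apply Sigma01_subst.
  - assert (E : subst s r (delta_comprehension q q')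
      = delta_comprehension (subst (up1 s) r q) (subst (up1 s) r q')).
    { unfold delta_comprehension; cbn; now rewrite subst_shift2. }
    rewrite E; apply RCA0_comprehension; [now apply Sigma01_subst|now apply Pi01_subst].
Qed.

Record RCA0_model : Type := {
  carrier :> model;
  num_name : nat -> num carrier;
  set_name : nat -> sets carrier;
  all_named : generated carrier num_name set_name;
  axioms_hold : forall p v e, RCA0 p -> sat carrier v e p }.

(** * Bounded definability with parameters *)

Section Definability.

Variable M : RCA0_model.

Local Notation v0 := (num_name M).
Local Notation e0 := (set_name M).

(** Beyond the first [n] indices the naming assignment takes over, so every element of the model is
    the value of a term and may occur as a parameter. *)
Fixpoint extend (n : nat) (w : nat -> num M) : nat -> num M :=
  match n with
  | 0 => v0
  | S n => scons (w 0) (extend n (fun i => w (S i)))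
  end.

(** [n]-ary operations and predicates given by terms and bounded formulas with
    parameters; only the first [n] entries of [w] may be used. *)
Definition tdef (n : nat) (f : (nat -> num M) -> num M) : Prop :=
  exists t, forall w, eval M (extend n w) t = f w.

Definition bdef (n : nat) (P : (nat -> num M) -> Prop) : Prop :=
  exists p, bounded p /\ forall w, sat M (extend n w) e0 p <-> P w.

Lemma extend_lt n : forall w i, i < n -> extend n w i = w i.
Proof.
  induction n as [|n IH]; intros w i Hi; [lia|].
  destruct i; cbn; [reflexivity|]; apply (IH (fun i => w (S i))); lia.
Qed.

Lemma extend_ge n : forall w i, extend n w (n + i) = v0 i.
Proof. induction n as [|n IH]; intros w i; cbn; [|apply (IH (fun i => w (S i)))]; reflexivity. Qed.

Lemma tdef_var n i : i < n -> tdef n (fun w => w i).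
Proof. intros Hi; exists (Var i); intros w; now apply extend_lt. Qed.

Lemma tdef_const n a : tdef n (fun _ => a).
Proof.
  destruct (proj1 (all_named M) a) as [t <-]; exists (tsubst (fun i => Var (n + i)) t).
  intros w; rewrite eval_tsubst; f_equal; extensionality i; apply extend_ge.
Qed.

Lemma tdef_add n f g : tdef n f -> tdef n g -> tdef n (fun w => madd M (f w) (g w)).
Proof. intros [t Ht] [u Hu]; exists (Plus t u); intros w; cbn; congruence. Qed.

Lemma tdef_mul n f g : tdef n f -> tdef n g -> tdef n (fun w => mmul M (f w) (g w)).
Proof. intros [t Ht] [u Hu]; exists (Times t u); intros w; cbn; congruence. Qed.

Lemma eval_tshift n w t :
  eval M (extend (S n) w) (tshift t) = eval M (extend n (fun i => w (S i))) t.
Proof. unfold tshift; now rewrite eval_tsubst. Qed.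

Lemma tdef_shift n f : tdef n f -> tdef (S n) (fun w => f (fun i => w (S i))).
Proof. intros [t Ht]; exists (tshift t); intros w; now rewrite eval_tshift, Ht. Qed.

Lemma tdef_shifts k n f : tdef n f -> tdef (k + n) (fun w => f (fun i => w (k + i))).
Proof.
  intros H; induction k as [|k IH]; [exact H|]; exact (tdef_shift _ _ IH).
Qed.

Lemma bdef_ext n P Q : (forall w, P w <-> Q w) -> bdef n Q -> bdef n P.
Proof. intros H [p [Hp Hs]]; exists p; split; [exact Hp|]; intros w; now rewrite H. Qed.

Lemma bdef_false n : bdef n (fun _ => False).
Proof. exists Bot; split; [constructor|cbn; tauto]. Qed.

Lemma bdef_eq n f g : tdef n f -> tdef n g -> bdef n (fun w => f w = g w).
Proof.
  intros [t Ht] [u Hu]; exists (Eq t u); split; [constructor|].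
  intros w; cbn; now rewrite Ht, Hu.
Qed.

Lemma bdef_lt n f g : tdef n f -> tdef n g -> bdef n (fun w => mlt M (f w) (g w)).
Proof.
  intros [t Ht] [u Hu]; exists (Lt t u); split; [constructor|].
  intros w; cbn; now rewrite Ht, Hu.
Qed.

Lemma bdef_mem n f X : tdef n f -> bdef n (fun w => mmem M (f w) X).
Proof.
  intros [t Ht]; destruct (proj2 (all_named M) X) as [i <-]; exists (Mem t i); split; [constructor|].
  intros w; cbn; now rewrite Ht.
Qed.

Lemma bdef_imp n P Q : bdef n P -> bdef n Q -> bdef n (fun w => P w -> Q w).
Proof.
  intros [p [Hp Hp']] [q [Hq Hq']]; exists (Imp p q); split; [now constructor|].
  intros w; cbn; now rewrite Hp', Hq'.
Qed.

Lemma bdef_not n P : bdef n P -> bdef n (fun w => ~ P w).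
Proof. intros H; exact (bdef_imp n _ _ H (bdef_false n)). Qed.

Lemma bdef_and n P Q : bdef n P -> bdef n Q -> bdef n (fun w => P w /\ Q w).
Proof.
  intros [p [Hp Hp']] [q [Hq Hq']]; exists (And p q); split; [now constructor|].
  intros w; cbn; now rewrite Hp', Hq'.
Qed.

Lemma bdef_or n P Q : bdef n P -> bdef n Q -> bdef n (fun w => P w \/ Q w).
Proof.
  intros [p [Hp Hp']] [q [Hq Hq']]; exists (Or p q); split; [now constructor|].
  intros w; cbn; now rewrite Hp', Hq'.
Qed.

Lemma bdef_iff n P Q : bdef n P -> bdef n Q -> bdef n (fun w => P w <-> Q w).
Proof. intros H H'; unfold iff; apply bdef_and; now apply bdef_imp. Qed.

Lemma bdef_all n f (P : num M -> (nat -> num M) -> Prop) :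
  tdef n f -> bdef (S n) (fun w => P (w 0) (fun i => w (S i))) ->
  bdef n (fun w => forall x, mlt M x (f w) -> P x w).
Proof.
  intros [t Ht] [p [Hp Hp']]; exists (All1 (Imp (Lt (Var 0) (tshift t)) p)).
  split; [now constructor|]; intros w; cbn.
  split; intros H x; specialize (H x); specialize (Hp' (scons x w)); cbn in Hp';
    unfold tshift in *; rewrite eval_tsubst in *; cbn in *; rewrite Ht in *;
    intros Hx; apply Hp', H, Hx.
Qed.

Lemma bdef_ex n f (P : num M -> (nat -> num M) -> Prop) :
  tdef n f -> bdef (S n) (fun w => P (w 0) (fun i => w (S i))) ->
  bdef n (fun w => exists x, mlt M x (f w) /\ P x w).
Proof.
  intros [t Ht] [p [Hp Hp']]; exists (Ex1 (And (Lt (Var 0) (tshift t)) p)).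
  split; [now constructor|]; intros w; cbn.
  split; intros [x [Hx H]]; exists x; specialize (Hp' (scons x w)); cbn in Hp';
    unfold tshift in *; rewrite eval_tsubst in *; cbn in *; rewrite Ht in *;
    split; [exact Hx|apply Hp', H|exact Hx|apply Hp', H].
Qed.

(** The induction variable is [w 1] and the witness [w 0], because the existential quantifier of the
    Sigma01 formula binds above the distinguished variable. *)
Lemma sigma_induction (R : num M -> num M -> Prop) :
  bdef 2 (fun w => R (w 1) (w 0)) ->
  (exists y, R (mzero M) y) ->
  (forall x, (exists y, R x y) -> exists y, R (madd M x (mone M)) y) ->
  forall x, exists y, R x y.
Proof.
  intros [p [Hp Hs]] H0 HS.
  assert (Hq : forall x, sat M (scons x v0) e0 (Ex1 p) <-> exists y, R x y).
  { intros x; cbn; split; intros [y Hy]; exists y;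
      apply (Hs (scons y (scons x v0))), Hy. }
  assert (HA := axioms_hold M (induction (Ex1 p)) v0 e0 (RCA0_induction _ (Sigma01_intro _ Hp))).
  unfold induction in HA.
  remember (Ex1 p) as q; cbn in HA.
  intros x; apply Hq, HA; split.
  - unfold inst1; apply sat_subst.
    eapply (eq_ind (scons (mzero M) v0) (fun v => sat M v e0 q)); [apply Hq, H0|].
    extensionality i; now destruct i.
  - intros y Hy; apply sat_subst.
    eapply (eq_ind (scons (madd M y (mone M)) v0) (fun v => sat M v e0 q));
      [apply Hq, HS, Hq, Hy|].
    extensionality i; now destruct i.
Qed.

(** A dummy quantifier in front makes a bounded formula Sigma01 and Pi01 alike, which turns Delta01
    comprehension into this form. *)
Lemma bounded_comprehension (P : num M -> Prop) :
  bdef 1 (fun w => P (w 0)) -> exists X, forall x, mmem M x X <-> P x.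
Proof.
  intros [p [Hp Hs]].
  assert (Hq : forall x y, sat M (scons y (scons x v0)) e0 (shift1 p) <-> P x).
  { intros x y; unfold shift1; rewrite sat_subst; apply (Hs (scons x v0)). }
  assert (Hb : bounded (shift1 p)) by now apply bounded_subst.
  assert (HA := axioms_hold M (delta_comprehension (Ex1 (shift1 p)) (All1 (shift1 p))) v0 e0
    (RCA0_comprehension _ _ (Sigma01_intro _ Hb) (Pi01_intro _ Hb))).
  remember (shift1 p) as q; cbn in HA; destruct HA as [X HX].
  - intros x; split.
    + intros [y Hy] z; apply Hq; now apply Hq in Hy.
    + intros H; exists x; apply H.
  - exists X; intros x; specialize (HX x); split.
    + intros H; apply HX in H; destruct H as [y Hy].
      rewrite up1_id in Hy; apply sat_subst in Hy; exact (proj1 (Hq x y) Hy).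
    + intros H; apply HX; exists x; rewrite up1_id; apply sat_subst, (Hq x x), H.
Qed.

End Definability.

(** Follows the shape of the predicate. The last clause carries a term definable in the outer
    variables under up to four bounded quantifiers. *)
Ltac definable :=
  cbv beta;
  match goal with
  | |- bdef _ _ (fun w => forall x, mlt _ x _ -> _) => eapply bdef_all
  | |- bdef _ _ (fun w => exists x, mlt _ x _ /\ _) => eapply bdef_ex
  | |- bdef _ _ (fun w => False) => eapply bdef_false
  | |- bdef _ _ (fun w => _ /\ _) => eapply bdef_and
  | |- bdef _ _ (fun w => _ \/ _) => eapply bdef_or
  | |- bdef _ _ (fun w => _ <-> _) => eapply bdef_iff
  | |- bdef _ _ (fun w => ~ _) => eapply bdef_not
  | |- bdef _ _ (fun w => _ -> _) => eapply bdef_imp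
  | |- bdef _ _ (fun w => _ = _) => eapply bdef_eq
  | |- bdef _ _ (fun w => mlt _ _ _) => eapply bdef_lt
  | |- bdef _ _ (fun w => mmem _ _ _) => eapply bdef_mem
  | |- tdef _ _ (fun w => w _) => eapply tdef_var; lia
  | |- tdef _ _ (fun w => madd _ _ _) => eapply tdef_add
  | |- tdef _ _ (fun w => mmul _ _ _) => eapply tdef_mul
  | |- tdef _ _ (fun w => ?c) => eapply tdef_const
  | H : tdef _ _ ?f |- tdef _ _ ?f => exact H
  | H : tdef _ _ ?f |- tdef _ _ (fun w => ?f (@?g w)) =>
      first [exact H | exact (tdef_shifts _ 1 _ _ H) | exact (tdef_shifts _ 2 _ _ H)
        | exact (tdef_shifts _ 3 _ _ H) | exact (tdef_shifts _ 4 _ _ H)]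
  end.
Ltac definability := repeat definable.

(** * Arithmetic in models of RCA0 *)

Declare Scope model_scope.

Section Arithmetic.

Variable M : RCA0_model.

Local Notation D := (num M).
Local Notation "0" := (mzero M) : model_scope.
Local Notation "1" := (mone M) : model_scope.
Local Infix "+" := (madd M) : model_scope.
Local Infix "*" := (mmul M) : model_scope.
Local Infix "<" := (mlt M) : model_scope.
Local Open Scope model_scope.
Local Notation "x <= y" := (x < y \/ x = y) : model_scope.

Lemma basic_holds p : basic_axiom p -> sat M (num_name M) (set_name M) p.
Proof. intros H; now apply axioms_hold, RCA0_basic. Qed.

Lemma succ_neq_zero (n : D) : n + 1 <> 0.
Proof. exact (basic_holds _ ax_succ_neq_zero n). Qed.

Lemma succ_inj (m n : D) : m + 1 = n + 1 -> m = n.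
Proof. exact (basic_holds _ ax_succ_inj m n). Qed.

Lemma add_zero (m : D) : m + 0 = m.
Proof. exact (basic_holds _ ax_add_zero m). Qed.

Lemma add_succ (m n : D) : m + (n + 1) = (m + n) + 1.
Proof. exact (basic_holds _ ax_add_succ m n). Qed.

Lemma mul_zero (m : D) : m * 0 = 0.
Proof. exact (basic_holds _ ax_mul_zero m). Qed.

Lemma mul_succ (m n : D) : m * (n + 1) = m * n + m.
Proof. exact (basic_holds _ ax_mul_succ m n). Qed.

Lemma lt_zero (m : D) : ~ m < 0.
Proof. exact (basic_holds _ ax_lt_zero m). Qed.

Lemma lt_succ (m n : D) : m < n + 1 <-> m <= n.
Proof. exact (basic_holds _ ax_lt_succ m n). Qed.

Lemma bounded_induction (P : D -> Prop) :
  bdef M 1%nat (fun w => P (w O)) -> P 0 -> (forall x, P x -> P (x + 1)) -> forall x, P x.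
Proof.
  intros [p [Hp Hs]] H0 HS x.
  destruct (sigma_induction M (fun x _ => P x)) with x as [_ H]; eauto.
  - exists (subst (fun i => Var (S i)) (fun X => X) p); split; [now apply bounded_subst|].
    intros w; rewrite sat_subst; apply (Hs (fun i => w (S i))).
  - intros y [_ Hy]; exists 0; auto.
Qed.

Lemma least_element (P : D -> Prop) : bdef M 1%nat (fun w => P (w O)) ->
  forall x, P x -> exists y, P y /\ forall z, z < y -> ~ P z.
Proof.
  intros HP x Hx; apply NNPP; intros Hn.
  assert (H : forall y z, z < y -> ~ P z).
  { apply (bounded_induction (fun y => forall z, z < y -> ~ P z)).
    - definability.
      destruct HP as [p [Hp Hs]].
      (* Index 1 now belongs to the bound [y], on which [P] does not depend, so the parameters of
         [p] move up past it. *)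
      exists (subst (fun i => match i with O => Var O | S i => Var (S (S i)) end)
        (fun X => X) p); split; [now apply bounded_subst|].
      intros w; rewrite sat_subst, <- (Hs w).
      match goal with |- sat _ ?v _ _ <-> sat _ ?v' _ _ => replace v with v' end;
        [reflexivity|extensionality i; now destruct i].
    - intros z Hz; now apply lt_zero in Hz.
    - intros y IH z Hz Pz; apply lt_succ in Hz; destruct Hz as [Hz| ->].
      + exact (IH z Hz Pz).
      + apply Hn; exists y; auto. }
  apply (H (x + 1) x); [apply lt_succ; now right|exact Hx].
Qed.

Lemma add_assoc (x y z : D) : x + (y + z) = (x + y) + z.
Proof.
  revert z; apply bounded_induction; [definability|now rewrite !add_zero|].
  intros z IH; now rewrite !add_succ, IH.
Qed.

Lemma zero_add (x : D) : 0 + x = x.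
Proof.
  revert x; apply bounded_induction; [definability|apply add_zero|].
  intros x IH; now rewrite add_succ, IH.
Qed.

Lemma one_add (x : D) : 1 + x = x + 1.
Proof.
  revert x; apply bounded_induction; [definability|now rewrite add_zero, zero_add|].
  intros x IH; now rewrite add_succ, IH.
Qed.

Lemma add_comm (x y : D) : x + y = y + x.
Proof.
  revert y; apply bounded_induction; [definability|now rewrite add_zero, zero_add|].
  intros y IH; now rewrite add_succ, IH, <- !add_assoc, one_add.
Qed.

Lemma zero_mul (x : D) : 0 * x = 0.
Proof.
  revert x; apply bounded_induction; [definability|apply mul_zero|].
  intros x IH; now rewrite mul_succ, IH, add_zero.
Qed.

Lemma succ_mul (x y : D) : (x + 1) * y = x * y + y.
Proof.
  revert y; apply bounded_induction; [definability|now rewrite !mul_zero, add_zero|].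
  intros y IH; rewrite !mul_succ, IH, <- !add_assoc; f_equal.
  now rewrite !add_assoc, (add_comm y x).
Qed.

Lemma mul_comm (x y : D) : x * y = y * x.
Proof.
  revert y; apply bounded_induction; [definability|now rewrite mul_zero, zero_mul|].
  intros y IH; now rewrite mul_succ, succ_mul, IH.
Qed.

Lemma mul_add_l (x y z : D) : (x + y) * z = x * z + y * z.
Proof.
  revert z; apply bounded_induction; [definability|now rewrite !mul_zero, add_zero|].
  intros z IH; rewrite !mul_succ, IH, <- !add_assoc; f_equal.
  now rewrite !add_assoc, (add_comm (y * z) x).
Qed.

Lemma mul_assoc (x y z : D) : x * (y * z) = (x * y) * z.
Proof.
  revert z; apply bounded_induction; [definability|now rewrite !mul_zero|].
  intros z IH; now rewrite !mul_succ, (mul_comm x (y * z + y)), mul_add_l,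
    (mul_comm _ x), IH, (mul_comm y x).
Qed.

Lemma one_mul (x : D) : 1 * x = x.
Proof. now rewrite <- (zero_add 1), succ_mul, zero_mul, zero_add. Qed.

Lemma num_semi_ring : semi_ring_theory 0 1 (madd M) (mmul M) eq.
Proof.
  constructor; auto using zero_add, add_comm, add_assoc, one_mul, zero_mul, mul_comm,
    mul_assoc, mul_add_l.
Qed.

Add Ring num_ring : num_semi_ring.

Lemma add_cancel (x y z : D) : x + z = y + z -> x = y.
Proof.
  revert z; apply (bounded_induction (fun z => x + z = y + z -> x = y));
    [definability|now rewrite !add_zero|].
  intros z IH H; rewrite !add_succ in H; now apply IH, succ_inj.
Qed.

Lemma add_succ_neq (x z : D) : x <> x + z + 1.
Proof.
  intros H; apply (succ_neq_zero z), (add_cancel _ _ x).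
  transitivity (x + z + 1); [ring|]; rewrite <- H; ring.
Qed.

Lemma lt_add_succ (x z : D) : z < x + z + 1.
Proof.
  revert x; apply bounded_induction; [definability| |].
  - apply lt_succ; right; ring.
  - intros x IH; replace (x + 1 + z + 1) with (x + z + 1 + 1) by ring.
    apply lt_succ; now left.
Qed.

Lemma lt_iff (x y : D) : x < y <-> exists z, y = x + z + 1.
Proof.
  split.
  (* Bounding the difference by [y] makes the claim fit for induction on a bounded formula. *)
  - intros H; assert (K : x < y -> exists z, z < y /\ y = x + z + 1);
      [clear H|destruct (K H) as [z [_ Hz]]; eauto].
    revert y; apply (bounded_induction
      (fun y => x < y -> exists z, z < y /\ y = x + z + 1)); [definability| |].
    + intros H; now apply lt_zero in H.
    + intros y IH H; apply lt_succ in H; destruct H as [H| ->].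
      * destruct (IH H) as [z [Hz ->]]; exists (z + 1); split; [|ring].
        replace (x + z + 1 + 1) with (x + (z + 1) + 1) by ring; apply lt_add_succ.
      * exists 0; split; [|ring]; rewrite <- (add_zero y) at 1.
        replace (y + 0 + 1) with (y + 0 + 1) by ring; apply lt_add_succ.
  - intros [z ->]; replace (x + z + 1) with (z + x + 1) by ring; apply lt_add_succ.
Qed.

Lemma lt_irrefl (x : D) : ~ x < x.
Proof. intros H; apply lt_iff in H; destruct H as [z H]; exact (add_succ_neq _ _ H). Qed.

Lemma lt_trans (x y z : D) : x < y -> y < z -> x < z.
Proof.
  rewrite !lt_iff; intros [a ->] [b ->]; exists (a + b + 1); ring.
Qed.

Lemma le_lt_trans (x y z : D) : x <= y -> y < z -> x < z.
Proof. intros [H| ->] H'; [eapply lt_trans; eauto|exact H']. Qed.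

Lemma lt_le_trans (x y z : D) : x < y -> y <= z -> x < z.
Proof. intros H [H'| <-]; [eapply lt_trans; eauto|exact H]. Qed.

Lemma le_trans (x y z : D) : x <= y -> y <= z -> x <= z.
Proof. intros [H| ->] H'; [left; eapply lt_le_trans; eauto|exact H']. Qed.

Lemma zero_or_succ (x : D) : x = 0 \/ exists y, x = y + 1.
Proof.
  assert (H : x = 0 \/ exists y, y < x /\ x = y + 1).
  { revert x; apply bounded_induction; [definability|now left|].
    intros x _; right; exists x; split; [apply lt_succ; now right|reflexivity]. }
  destruct H as [H|[y [_ H]]]; eauto.
Qed.

Lemma le_iff (x y : D) : x <= y <-> exists z, y = x + z.
Proof.
  split.
  - intros [H| ->]; [apply lt_iff in H; destruct H as [z ->]; exists (z + 1)|exists 0]; ring.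
  - intros [z ->]; destruct (zero_or_succ z) as [->|[u ->]]; [right; ring|left].
    apply lt_iff; exists u; ring.
Qed.

Lemma zero_le (x : D) : 0 <= x.
Proof. apply le_iff; exists x; ring. Qed.

Lemma lt_succ_self (x : D) : x < x + 1.
Proof. apply lt_succ; now right. Qed.

Lemma lt_succ_le (x y : D) : x < y <-> x + 1 <= y.
Proof.
  rewrite lt_iff, le_iff; split; intros [z ->]; exists z; ring.
Qed.

Lemma lt_trichotomy (x y : D) : x < y \/ x = y \/ y < x.
Proof.
  revert x; apply bounded_induction; [definability| |].
  - destruct (zero_le y); auto.
  - intros x [H|[->|H]].
    + apply lt_succ_le in H; destruct H; auto.
    + right; right; apply lt_succ_self.
    + right; right; apply lt_succ; now left.
Qed.

Lemma not_lt (x y : D) : ~ x < y <-> y <= x.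
Proof.
  split; intros H.
  - destruct (lt_trichotomy x y) as [H'|[->|H']]; [contradiction|now right|now left].
  - intros H'; exact (lt_irrefl _ (lt_le_trans _ _ _ H' H)).
Qed.

Lemma add_eq_zero (x y : D) : x + y = 0 -> y = 0.
Proof.
  destruct (zero_or_succ y) as [->|[z ->]]; [easy|].
  rewrite add_succ; intros H; now apply succ_neq_zero in H.
Qed.

Lemma pos_iff (x : D) : 0 < x <-> exists y, x = y + 1.
Proof. rewrite lt_iff; split; intros [y ->]; exists y; ring. Qed.

Lemma le_mul_pos (x y : D) : 0 < y -> x <= y * x.
Proof.
  rewrite pos_iff; intros [z ->]; apply le_iff; exists (z * x); ring.
Qed.

Lemma mul_pos (x y : D) : 0 < x -> 0 < y -> 0 < x * y.
Proof.
  rewrite !pos_iff; intros [a ->] [b ->]; exists (a * b + a + b); ring.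
Qed.

(** * The pairing function *)

Definition pair (x y : D) : D := (x + y) * (x + y) + x.

Lemma le_square (x : D) : x <= x * x.
Proof.
  destruct (zero_or_succ x) as [->|[y ->]]; [right; ring|].
  apply le_mul_pos, pos_iff; eauto.
Qed.

Lemma le_pair_l (x y : D) : x <= pair x y.
Proof. apply le_iff; exists ((x + y) * (x + y)); unfold pair; ring. Qed.

Lemma le_pair_r (x y : D) : y <= pair x y.
Proof.
  apply le_trans with (x + y); [apply le_iff; exists x; ring|].
  apply le_trans with ((x + y) * (x + y)); [apply le_square|].
  apply le_iff; exists x; reflexivity.
Qed.

(* Squares of consecutive numbers are more than [x] apart once [x <= x + y]. *)
Lemma pair_sum_not_lt (x y x' y' : D) : pair x y = pair x' y' -> ~ x + y < x' + y'.
Proof.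
  intros E H; apply lt_iff in H; destruct H as [k H]; unfold pair in E; rewrite H in E.
  apply (add_succ_neq ((x + y) * (x + y) + x)
    (y + (x + y) + (x + y) * k + (x + y) * k + k * k + k + k + x')).
  transitivity ((x + y + k + 1) * (x + y + k + 1) + x'); [exact E|ring].
Qed.

Lemma pair_inj (x y x' y' : D) : pair x y = pair x' y' -> x = x' /\ y = y'.
Proof.
  intros E; assert (Es : x + y = x' + y').
  { destruct (lt_trichotomy (x + y) (x' + y')) as [H|[H|H]]; [|exact H|];
      now apply pair_sum_not_lt in H. }
  assert (Ex : x = x').
  { unfold pair in E; rewrite Es, !(add_comm (_ * _)) in E; exact (add_cancel _ _ _ E). }
  split; [exact Ex|]; subst x'.
  apply (add_cancel _ _ x); now rewrite !(add_comm _ x).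
Qed.

(** * Divisibility and coprime moduli *)

Definition dvd (a b : D) : Prop := exists q, b = a * q.

(** Without subtraction the two quotients are compared: if that of the sum is the smaller one, [c]
    must be 0; otherwise their difference is the quotient of [c]. *)
Lemma dvd_add_cancel (a b c : D) : dvd a b -> dvd a (b + c) -> dvd a c.
Proof.
  intros [p ->] [q Hq]; destruct (lt_trichotomy q p) as [H|H].
  - apply lt_iff in H; destruct H as [r ->]; exists 0; rewrite mul_zero.
    apply (add_eq_zero (a * (r + 1))), (add_cancel _ _ (a * q)).
    transitivity (a * (q + r + 1) + c); [ring|]; rewrite Hq; ring.
  - assert (Hle : p <= q) by (destruct H; auto).
    apply le_iff in Hle; destruct Hle as [r ->]; exists r.
    apply (add_cancel _ _ (a * p)); rewrite (add_comm c), Hq; ring.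
Qed.

Lemma dvd_mul_r (a b c : D) : dvd a b -> dvd a (c * b).
Proof. intros [q ->]; exists (c * q); ring. Qed.

Lemma dvd_self_mul (a b : D) : dvd a (a * b).
Proof. now exists b. Qed.

(** The moduli of Goedel's beta function. *)
Definition modulus (m i : D) : D := m * (i + 1) + 1.

Lemma modulus_pos (m i : D) : 0 < modulus m i.
Proof. apply pos_iff; eexists; reflexivity. Qed.

(** The modulus is 1 more than a multiple of [m]: [(i + 1) * (m * u) + u] equals
    [modulus m i * u]. *)
Lemma modulus_coprime_m (m i u : D) : dvd (modulus m i) (m * u) -> dvd (modulus m i) u.
Proof.
  intros H; apply (dvd_add_cancel _ ((i + 1) * (m * u))); [now apply dvd_mul_r|].
  exists u; unfold modulus; ring.
Qed.

(** Two moduli differ by [m * (k + 1)], where [k + 1] is the distance of [x] and [y] and hence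
    divides [m]. So the modulus of [y] divides [m * (k + 1) * z]; the factor [m] cancels, [k + 1] is
    completed to [m], and [m] cancels again. *)
Lemma modulus_coprime (m b x y z : D) :
  (forall j, j < b -> dvd (j + 1) m) -> x < b -> y < b -> x <> y ->
  dvd (modulus m y) (modulus m x * z) -> dvd (modulus m y) z.
Proof.
  intros Hm Hx Hy Hxy H.
  assert (K : exists k, k < b /\ dvd (modulus m y) (m * ((k + 1) * z))).
  { destruct (lt_trichotomy x y) as [L|[L|L]]; [|contradiction|];
      apply lt_iff in L; destruct L as [k ->]; exists k; split.
    - eapply lt_trans; [|exact Hy]; apply lt_add_succ.
    - apply (dvd_add_cancel _ _ _ H); exists z; unfold modulus; ring.
    - eapply lt_trans; [|exact Hx]; apply lt_add_succ.
    - apply (dvd_add_cancel _ (modulus m y * z)); [apply dvd_self_mul|].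
      replace (modulus m y * z + m * ((k + 1) * z)) with (modulus m (y + k + 1) * z);
        [exact H|unfold modulus; ring]. }
  destruct K as [k [Hk K]]; apply modulus_coprime_m in K.
  destruct (Hm k Hk) as [t Ht]; apply modulus_coprime_m.
  replace (m * z) with (t * ((k + 1) * z)) by (rewrite Ht; ring).
  now apply dvd_mul_r.
Qed.

(** The divisor is written as a successor because a positive divisor bounds the quotient by the
    dividend. *)
Lemma bdef_dvd n f g : tdef M n f -> tdef M n g ->
  bdef M n (fun w => dvd (f w + 1) (g w)).
Proof.
  intros Hf Hg.
  apply bdef_ext with (fun w => exists q, q < g w + 1 /\ g w = (f w + 1) * q).
  - intros w; split.
    + intros [q Hq]; exists q; split; [|exact Hq].
      apply lt_succ; rewrite Hq; apply le_mul_pos, pos_iff; eauto.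
    + intros [q [_ Hq]]; now exists q.
  - definability.
Qed.

(** In effect a factorial, built one factor at a time by Sigma01 induction. *)
Lemma common_multiple_exists (b : D) :
  exists m, 0 < m /\ forall j, j < b -> dvd (j + 1) m.
Proof.
  revert b; apply sigma_induction.
  - definability. apply (bdef_dvd 3 (fun w => w O) (fun w => w 1%nat)); definability.
  - exists 1; split; [apply pos_iff; exists 0; ring|].
    intros j Hj; now apply lt_zero in Hj.
  - intros b [m [Hm Hd]]; exists (m * (b + 1)); split.
    + apply mul_pos; [exact Hm|apply pos_iff; eauto].
    + intros j Hj; apply lt_succ in Hj; destruct Hj as [Hj| ->].
      * rewrite mul_comm; apply dvd_mul_r, Hd, Hj.
      * apply dvd_mul_r; exists 1; ring.
Qed.

(** The product starts from [m] instead of 1 to secure [m <= v], which bounds the quantifier over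
    [m] in [wide]. *)
Lemma common_modulus_multiple_exists (m b : D) : 0 < m ->
  exists v, 0 < v /\ m <= v /\ forall j, j < b -> dvd (modulus m j) v.
Proof.
  intros Hm; revert b; apply sigma_induction.
  - definability.
    apply (bdef_dvd 3 (fun w => m * (w O + 1)) (fun w => w 1%nat)); definability.
  - exists m; repeat split; [exact Hm|now right|].
    intros j Hj; now apply lt_zero in Hj.
  - intros b [v [Hv [Hmv Hd]]]; exists (modulus m b * v); repeat split.
    + apply mul_pos; [apply modulus_pos|exact Hv].
    + apply le_trans with v; [exact Hmv|apply le_mul_pos, modulus_pos].
    + intros j Hj; apply lt_succ in Hj; destruct Hj as [Hj| ->].
      * apply dvd_mul_r, Hd, Hj.
      * apply dvd_self_mul.
Qed.

(** * Codes of finite sequences *)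

Definition coded (i c : D) : Prop :=
  exists k m n, c = pair k (pair m n) /\ i < k /\ dvd (modulus m i) n.

Definition length_eq (l n : D) : Prop := forall i, i < n <-> exists x, coded (pair i x) l.

Definition ran (l x : D) : Prop := exists n, length_eq l n /\ exists i, i < n /\ coded (pair i x) l.

Lemma coded_lt (i c : D) : coded i c -> i < c.
Proof.
  intros (k & m & n & -> & H & _); eapply lt_le_trans; [exact H|apply le_pair_l].
Qed.

Lemma coded_pair_lt (i x c : D) : coded (pair i x) c -> i < c /\ x < c.
Proof.
  intros H; apply coded_lt in H.
  split; (eapply le_lt_trans; [|exact H]); [apply le_pair_l|apply le_pair_r].
Qed.

Lemma ran_lt (l x : D) : ran l x -> x < l.
Proof. intros (n & _ & i & _ & H); now apply coded_pair_lt in H. Qed.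

Lemma bdef_coded n f g : tdef M n f -> tdef M n g -> bdef M n (fun w => coded (f w) (g w)).
Proof.
  intros Hf Hg.
  apply bdef_ext with (fun w => exists k, k < g w + 1 /\ exists a, a < g w + 1 /\
    exists b, b < g w + 1 /\ g w = pair k (pair a b) /\ f w < k /\
      dvd (a * (f w + 1) + 1) b).
  - intros w; split.
    + intros (k & a & b & E & Hk & Hd); exists k; rewrite !lt_succ.
      split; [rewrite E; apply le_pair_l|]; exists a; rewrite lt_succ.
      assert (H : pair a b <= g w) by (rewrite E; apply le_pair_r).
      split; [eapply le_trans; [apply le_pair_l|exact H]|]; exists b; rewrite lt_succ.
      split; [eapply le_trans; [apply le_pair_r|exact H]|]; auto.
    + intros (k & _ & a & _ & b & _ & H); exists k, a, b; exact H.
  - unfold pair; definability; try (apply bdef_dvd); definability.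
Qed.

(** A code exceeds the index and the value of each of its entries, so the length is at most [l] and
    the equivalence need only be tested up to [l]. *)
Lemma length_eq_iff (l n : D) : length_eq l n <->
  n <= l /\ forall i, i < l + 1 -> (i < n <-> exists x, x < l /\ coded (pair i x) l).
Proof.
  split.
  - intros H; split.
    + apply not_lt; intros Hl; apply H in Hl; destruct Hl as [x Hx].
      apply coded_pair_lt in Hx; now apply (lt_irrefl l).
    + intros i _; rewrite (H i); split; intros [x Hx]; exists x;
        [split; [eapply coded_pair_lt|]; exact Hx|apply Hx].
  - intros [Hn H] i; split.
    + intros Hi; apply H in Hi; [destruct Hi as (x & _ & Hx); now exists x|].
      apply lt_succ; left; eapply lt_le_trans; eassumption.
    + intros [x Hx]; destruct (coded_pair_lt _ _ _ Hx).
      apply H; [apply lt_succ; now left|eauto].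
Qed.

Lemma bdef_ran n f g : tdef M n f -> tdef M n g -> bdef M n (fun w => ran (f w) (g w)).
Proof.
  intros Hf Hg.
  apply bdef_ext with (fun w => exists a, a < f w + 1 /\
    (forall i, i < f w + 1 ->
      (i < a <-> exists x, x < f w /\ coded (pair i x) (f w))) /\
    exists i, i < a /\ coded (pair i (g w)) (f w)).
  - intros w; unfold ran; split; intros (a & H).
    + exists a; rewrite lt_succ; rewrite length_eq_iff in H; tauto.
    + exists a; rewrite lt_succ in H; rewrite length_eq_iff; tauto.
  - definability; try (apply bdef_coded; unfold pair); definability.
Qed.

(** * A weak pigeonhole principle *)

(** The initial segment spanned by the range. It carries exactly the information of the largest
    element, and treats an empty range uniformly. *)
Definition down (l j : D) : Prop := exists i, ran l i /\ j <= i.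

(** The moduli are pairwise coprime, so such a [v] exceeds the number of elements of the
    range of [l]. *)
Definition wide (l v : D) : Prop :=
  0 < v /\ exists m, 0 < m /\ m <= v /\
    forall j, down l j -> dvd (j + 1) m /\ dvd (modulus m j) v.

Lemma down_lt (l j : D) : down l j -> j < l.
Proof. intros (i & Hi & H); eapply le_lt_trans; [exact H|apply ran_lt, Hi]. Qed.

Lemma bdef_down n f g : tdef M n f -> tdef M n g -> bdef M n (fun w => down (f w) (g w)).
Proof.
  intros Hf Hg.
  apply bdef_ext with (fun w => exists i, i < f w /\ ran (f w) i /\ g w <= i).
  - intros w; split; intros (i & H); exists i; [|tauto].
    split; [apply ran_lt|]; apply H.
  - definability; try (apply bdef_ran); definability.
Qed.

Lemma bdef_wide n f g : tdef M n f -> tdef M n g -> bdef M n (fun w => wide (f w) (g w)).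
Proof.
  intros Hf Hg.
  apply bdef_ext with (fun w => 0 < g w /\ exists m, m < g w + 1 /\ 0 < m /\
    forall j, j < f w -> down (f w) j -> dvd (j + 1) m /\ dvd (m * (j + 1) + 1) (g w)).
  - intros w; unfold wide; split; intros [Hv (m & H)].
    + split; [exact Hv|]; exists m; rewrite lt_succ; repeat split; try apply H; auto.
    + split; [exact Hv|]; exists m; rewrite lt_succ in H; repeat split; try apply H;
        auto using down_lt.
  - definability; try (apply bdef_dvd || apply bdef_down); definability.
Qed.

Lemma wide_exists (l : D) : exists v, wide l v.
Proof.
  destruct (common_multiple_exists l) as (m & Hm & Hd).
  destruct (common_modulus_multiple_exists m l Hm) as (v & Hv & Hmv & Hd').
  exists v; split; [exact Hv|]; exists m; repeat split; auto using down_lt.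
Qed.

(* By induction on [j]: [v = d * z] with [d > j], where [z] is still divisible by the
   moduli of all elements of the range that are not among [g(0), ..., g(j - 1)]. *)
Lemma injection_lt_wide (l v m' : D) (g : sets M) :
  wide l v ->
  (forall x, x < m' -> exists y, ran l y /\ mmem M (pair x y) g) ->
  (forall x x' y, mmem M (pair x y) g -> mmem M (pair x' y) g -> x = x') ->
  m' < v.
Proof.
  intros [Hv (m & Hm & Hmv & Hd)] Hg Hinj.
  (* Coprimality needs every positive number up to the larger of [x] and [y], plus 1, to divide [m];
     this is why [wide] speaks of [down] and not of the range alone. *)
  assert (Hco : forall x y z, ran l x -> ran l y -> x <> y ->
    dvd (modulus m y) (modulus m x * z) -> dvd (modulus m y) z).
  { assert (Hdown : forall b, ran l b -> forall j, j < b + 1 -> dvd (j + 1) m).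
    { intros b Hb j Hj; apply Hd; exists b; split; [exact Hb|now apply lt_succ]. }
    intros x y z Hx Hy Hxy; destruct (lt_trichotomy x y) as [L|[L|L]]; [|contradiction|].
    - apply (modulus_coprime m (y + 1) x y z (Hdown y Hy)); auto using lt_succ_self.
      apply lt_succ; now left.
    - apply (modulus_coprime m (x + 1) x y z (Hdown x Hx)); auto using lt_succ_self.
      apply lt_succ; now left. }
  (* The divisor [d] is the unbounded Sigma01 witness; the cofactor [z] is bounded by [v]. For [j]
     beyond [m'] any [d] will do. *)
  assert (H : forall j, exists d, j <= m' -> exists z, z < v + 1 /\ d * z = v /\
    j + 1 <= d /\ forall y, y < l -> ran l y ->
      (forall x, x < j -> ~ mmem M (pair x y) g) -> dvd (m * (y + 1) + 1) z).
  { apply (sigma_induction M).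
    - unfold pair; definability; try (apply bdef_dvd || apply bdef_ran); definability.
    - exists 1; intros _; exists v; repeat split.
      + apply lt_succ_self.
      + ring.
      + right; ring.
      + intros y _ Hy _; apply Hd; exists y; auto.
    - intros j [d IH].
      destruct (classic (j + 1 <= m')) as [Hj|Hj]; [|exists 0; contradiction].
      apply lt_succ_le in Hj.
      destruct IH as (z & _ & Ez & Hjd & Hz); [now left|].
      destruct (Hg j Hj) as (y0 & Hy0 & Hgj).
      (* By injectivity the new image [y0] has not occurred before, so its modulus still divides [z]
         and can be moved over to [d]. *)
      destruct (Hz y0) as [z' Ez']; [now apply ran_lt|exact Hy0| |].
      { intros x Hx Hgx; rewrite (Hinj _ _ _ Hgx Hgj) in Hx; now apply lt_irrefl in Hx. }
      fold (modulus m y0) in Ez'; subst z.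
      assert (Hd0 : 0 < d).
      { eapply lt_le_trans; [|exact Hjd]; apply pos_iff; eauto. }
      exists (d * modulus m y0); intros _; exists z'; repeat split.
      + apply lt_succ; rewrite <- Ez, mul_assoc.
        apply le_mul_pos, mul_pos; [exact Hd0|apply modulus_pos].
      + rewrite <- Ez; ring.
      (* Since [m] is positive, each modulus is at least 2, so [d] at least doubles and stays ahead
         of [j]. *)
      + apply pos_iff in Hm; destruct Hm as [p ->].
        apply le_iff in Hjd; destruct Hjd as [e ->].
        apply le_iff.
        exists ((j + 1 + e) * ((p + 1) * y0 + p) + e + e + j); unfold modulus; ring.
      + intros y Hyl Hy Hyx.
        apply (Hco y0); [exact Hy0|exact Hy| |].
        * intros <-; apply (Hyx j); [apply lt_succ_self|exact Hgj].
        * apply Hz; [exact Hyl|exact Hy|].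
          intros x Hx; apply Hyx, lt_succ; now left. }
  destruct (H m') as [d Hd']; destruct Hd' as (z & _ & Ez & Hlt & _); [now right|].
  apply lt_succ_le in Hlt; eapply lt_le_trans; [exact Hlt|].
  rewrite <- Ez, mul_comm; apply le_mul_pos.
  destruct (zero_le z) as [Hz|<-]; [exact Hz|].
  rewrite mul_zero in Ez; subst v; now apply lt_irrefl in Hv.
Qed.

(** * The functional defeating a coloring with bounded fibers *)

(** Left as satisfaction of [is_seq], so that the satisfied principles convert to statements about
    the model without opening the coding. *)
Definition seq (l : D) : Prop :=
  sat M (scons l (num_name M)) (set_name M) (is_seq (fun d => Var (d - 1)) 1%nat O).

Definition any : D -> Prop := fun _ => ~ False.

Definition func_on (f : sets M) (P Q : D -> Prop) : Prop :=
  (forall z, mmem M z f -> exists x y, P x /\ Q y /\ z = pair x y)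
  /\ (forall x, P x -> exists y, mmem M (pair x y) f)
  /\ (forall x y y', mmem M (pair x y) f -> mmem M (pair x y') f -> y = y').

Definition bij (g : sets M) (P Q : D -> Prop) : Prop :=
  func_on g P Q
  /\ (forall x x' y, mmem M (pair x y) g -> mmem M (pair x' y) g -> x = x')
  /\ (forall y, Q y -> exists x, mmem M (pair x y) g).

Definition more_than (P : D -> Prop) (v : D) : Prop :=
  exists m, v < m /\ exists g, bij g (fun x => x < m) P.

Definition ext_functional (F : sets M) : Prop :=
  forall l l', seq l -> seq l' -> (forall x, ran l x <-> ran l' x) ->
    exists v, mmem M (pair l v) F /\ mmem M (pair l' v) F.

Definition nested (L : sets M) : Prop :=
  func_on L any seq
  /\ (forall m l l', mmem M (pair m l) L -> mmem M (pair (m + 1) l') L ->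
        forall x, ran l x -> ran l' x)
  /\ exists U, forall x, mmem M x U <-> exists m l, mmem M (pair m l) L /\ ran l x.

Definition stable (F L : sets M) : Prop :=
  exists i, forall j, i <= j -> exists a b v,
    mmem M (pair i a) L /\ mmem M (pair j b) L /\ mmem M (pair a v) F /\ mmem M (pair b v) F.

Definition bounded_class (P : D -> Prop) : Prop := exists b, forall x, P x -> x < b.

Definition w_converges (L A : sets M) : Prop :=
  forall B, bounded_class (fun x => mmem M x B) ->
    exists i, forall j, i <= j -> exists l, mmem M (pair j l) L /\
      forall x, (ran l x /\ mmem M x B) <-> (mmem M x A /\ mmem M x B).

Definition w_convergent (L : sets M) : Prop :=
  func_on L any seq /\ exists A, ~ bounded_class (fun x => mmem M x A) /\ w_converges L A.

(** * A fixed coloring with bounded fibers *)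

Section Coloring.

Variables (n : D) (f : sets M).
Hypotheses (Hf : func_on f any (fun y => y <= n))
  (Hfib : forall c, c <= n -> bounded_class (fun x => mmem M (pair x c) f)).

Definition homogeneous (l : D) : Prop :=
  forall x y c, ran l x -> ran l y -> c <= n -> mmem M (pair x c) f -> mmem M (pair y c) f.

Definition value (l v : D) : Prop :=
  (homogeneous l /\ wide l v /\ forall u, u < v -> ~ wide l u) \/ (~ homogeneous l /\ v = 0).

Lemma color (x : D) : exists c, c <= n /\ mmem M (pair x c) f.
Proof.
  destruct (proj1 (proj2 Hf) x) as [c Hc]; [easy|]; exists c; split; [|exact Hc].
  destruct (proj1 Hf _ Hc) as (x' & c' & _ & Hc' & E).
  now apply pair_inj in E; destruct E as [_ ->].
Qed.

Lemma bdef_homogeneous k g : tdef M k g -> bdef M k (fun w => homogeneous (g w)).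
Proof.
  intros Hg.
  apply bdef_ext with (fun w => forall x, x < g w -> forall y, y < g w ->
    forall c, c < n + 1 -> ran (g w) x -> ran (g w) y ->
    mmem M (pair x c) f -> mmem M (pair y c) f).
  - intros w; split.
    + intros H x _ y _ c Hc Hx Hy; apply lt_succ in Hc; now apply H.
    + intros H x y c Hx Hy Hc; apply H; auto using ran_lt; now apply lt_succ.
  - unfold pair; definability; try (apply bdef_ran); definability.
Qed.

Lemma bdef_value k g h : tdef M k g -> tdef M k h -> bdef M k (fun w => value (g w) (h w)).
Proof.
  intros Hg Hh; unfold value; definability;
    try (apply bdef_homogeneous || apply bdef_wide); definability.
Qed.

Lemma value_exists (l : D) : exists v, value l v.
Proof.
  destruct (classic (homogeneous l)) as [H|H]; [|exists 0; right; auto].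
  destruct (wide_exists l) as [v Hv].
  destruct (least_element (fun v => wide l v)) with v as [u [Hu Hu']]; [|exact Hv|].
  - apply bdef_wide; definability.
  - exists u; left; auto.
Qed.

Lemma value_unique (l v v' : D) : value l v -> value l v' -> v = v'.
Proof.
  intros [(H & Hv & Hl)|[H ->]] [(H' & Hv' & Hl')|[H' ->]]; try contradiction; auto.
  destruct (lt_trichotomy v v') as [L|[L|L]]; [|exact L|]; exfalso.
  - exact (Hl' _ L Hv).
  - exact (Hl _ L Hv').
Qed.

(** Being wide refers to the range only through [down], so the least wide number is the same for
    both. *)
Lemma value_of_down (l l' v : D) : homogeneous l -> homogeneous l' ->
  (forall j, down l j <-> down l' j) -> value l v -> value l' v.
Proof.
  intros H H' Hdown [(_ & Hv & Hl)|[Hn _]]; [|contradiction].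
  assert (E : forall u, wide l u <-> wide l' u).
  { intros u; unfold wide.
    split; intros [Hu (m & Hm & Hmu & Hd)]; split; auto; exists m; repeat split; auto;
      apply Hd, Hdown; assumption. }
  left; split; [exact H'|]; split; [now apply E|].
  intros u Hu Hw; apply (Hl u Hu), E, Hw.
Qed.

Lemma homogeneous_sub (l l' : D) :
  (forall x, ran l x -> ran l' x) -> homogeneous l' -> homogeneous l.
Proof. intros H H' x y c Hx Hy; apply H'; auto. Qed.

Lemma down_sub (l l' : D) :
  (forall x, ran l x -> ran l' x) -> forall j, down l j -> down l' j.
Proof. intros H j (i & Hi & Hj); exists i; auto. Qed.

Lemma value_ext (l l' v : D) :
  (forall x, ran l x <-> ran l' x) -> value l v -> value l' v.
Proof.
  intros H Hv; destruct (classic (homogeneous l)) as [Hl|Hl].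
  - apply (value_of_down l); [exact Hl| | |exact Hv].
    + apply (homogeneous_sub _ l); [apply H|exact Hl].
    + intros j; split; apply down_sub; apply H.
  - destruct Hv as [[Hl' _]|[_ ->]]; [contradiction|]; right; split; [|reflexivity].
    intros Hl'; apply Hl, (homogeneous_sub _ l'); [apply H|exact Hl'].
Qed.

(** A pair bounds both of its entries and [value] is bounded-definable, so comprehension yields the
    graph as a set. *)
Lemma functional_exists : exists F,
  func_on F any any /\ ext_functional F /\ forall l v, mmem M (pair l v) F <-> value l v.
Proof.
  destruct (bounded_comprehension M (fun z => exists l, l < z + 1 /\ exists v, v < z + 1 /\
    z = pair l v /\ value l v)) as [F HF].
  { unfold pair; definability; apply bdef_value; definability. }
  assert (HF' : forall l v, mmem M (pair l v) F <-> value l v).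
  { intros l v; rewrite HF; split.
    - intros (l' & _ & v' & _ & E & Hv); apply pair_inj in E; now destruct E as [-> ->].
    - intros Hv; exists l; rewrite lt_succ; split; [apply le_pair_l|].
      exists v; rewrite lt_succ; split; [apply le_pair_r|auto]. }
  exists F; split; [|split; [|exact HF']].
  - repeat split.
    + intros z Hz; apply HF in Hz; destruct Hz as (l & _ & v & _ & E & _).
      exists l, v; split; [easy|split; [easy|exact E]].
    + intros l _; destruct (value_exists l) as [v Hv]; exists v; now apply HF'.
    + intros l v v'; rewrite !HF'; apply value_unique.
  - intros l l' _ _ H; destruct (value_exists l) as [v Hv]; exists v.
    rewrite !HF'; eauto using value_ext.
Qed.

Lemma not_homogeneous_stable (F L : sets M) (i : D) :
  (forall l v, mmem M (pair l v) F <-> value l v) ->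
  (forall j, i <= j -> exists l, mmem M (pair j l) L /\ ~ homogeneous l) ->
  stable F L.
Proof.
  intros HF H; exists i; intros j Hj.
  destruct (H i) as (a & Ha & Hna); [now right|].
  destruct (H j Hj) as (b & Hb & Hnb).
  exists a, b, 0; rewrite !HF; repeat split; auto; right; auto.
Qed.

(** Induction on the distance of the stages with [x] fixed; the stage reached is the Sigma01
    witness. *)
Lemma nested_mono (L : sets M) : nested L ->
  forall i j l l', i <= j -> mmem M (pair i l) L -> mmem M (pair j l') L ->
  forall x, ran l x -> ran l' x.
Proof.
  intros ((_ & Htot & Huniq) & Hstep & _) i j l l' Hij Hl Hl' x Hx.
  apply le_iff in Hij; destruct Hij as [k ->].
  assert (H : forall k, exists l', mmem M (pair (i + k) l') L /\ ran l' x).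
  { apply (sigma_induction M).
    - unfold pair; definability; apply bdef_ran; definability.
    - exists l; now rewrite add_zero.
    - intros h (a & Ha & Hax); destruct (Htot (i + h + 1)) as [b Hb]; [easy|].
      exists b; rewrite add_succ; split; [exact Hb|]; exact (Hstep _ _ _ Ha Hb x Hax). }
  destruct (H k) as (a & Ha & Hax); now rewrite (Huniq _ _ _ Hl' Ha).
Qed.

(** The maximum is the predecessor of the least strict upper bound; the known bound [b] keeps the
    minimized predicate bounded. *)
Lemma max_exists (U : sets M) : bounded_class (fun x => mmem M x U) ->
  forall x, mmem M x U -> exists y, mmem M y U /\ forall z, mmem M z U -> z <= y.
Proof.
  intros [b Hb] x Hx.
  destruct (least_element (fun c => forall y, y < b -> mmem M y U -> y < c)) with b
    as [c [Hc Hmin]]; [definability|auto|].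
  destruct (zero_or_succ c) as [->|[y ->]]; [now apply Hc, lt_zero in Hx; auto|].
  exists y; assert (Hle : forall z, mmem M z U -> z <= y).
  { intros z Hz; apply lt_succ, Hc; auto. }
  split; [|exact Hle]; apply NNPP; intros Hy.
  apply (Hmin y (lt_succ_self y)); intros z _ Hz.
  destruct (Hle z Hz) as [H| ->]; [exact H|contradiction].
Qed.

Lemma le_total (x y : D) : x <= y \/ y <= x.
Proof. destruct (lt_trichotomy x y) as [H|[H|H]]; auto. Qed.

Lemma functional_AS (F L : sets M) :
  (forall l v, mmem M (pair l v) F <-> value l v) -> nested L -> stable F L.
Proof.
  intros HF HL; assert (Hmono := nested_mono L HL).
  destruct HL as ((_ & Htot & Huniq) & _ & U & HU).
  destruct (classic (forall i l, mmem M (pair i l) L -> homogeneous l)) as [Hhom|Hhom].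
  2: { apply not_all_ex_not in Hhom; destruct Hhom as [i Hhom].
    apply not_all_ex_not in Hhom; destruct Hhom as [l Hl].
    apply imply_to_and in Hl; destruct Hl as [Hl Hn].
    apply (not_homogeneous_stable F L i HF); intros j Hj.
    destruct (Htot j) as [l' Hl']; [easy|]; exists l'; split; [exact Hl'|].
    intros H; apply Hn, (homogeneous_sub l l'); [exact (Hmono _ _ _ _ Hj Hl Hl')|exact H]. }
  (* From this stage on the spanned initial segment no longer grows, and the value of a homogeneous
     set sees nothing else. *)
  assert (K : exists i, forall j a b, i <= j -> mmem M (pair i a) L -> mmem M (pair j b) L ->
    forall x, down b x -> down a x).
  { destruct (classic (exists x, mmem M x U)) as [[x Hx]|Hempty].
    (* Any two elements of the union occur together at the later of their stages, so all of them
       share the color of [x]. *)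
    - assert (Hbd : bounded_class (fun y => mmem M y U)).
      { destruct (color x) as (c & Hc & Hxc), (Hfib c Hc) as [b Hb].
        exists b; intros y Hy; apply Hb.
        apply HU in Hx, Hy; destruct Hx as (i & l & Hl & Hlx), Hy as (j & l' & Hl' & Hly).
        destruct (le_total i j) as [Hij|Hij].
        - apply (Hhom j l' Hl' x y c); auto; exact (Hmono _ _ _ _ Hij Hl Hl' _ Hlx).
        - apply (Hhom i l Hl x y c); auto; exact (Hmono _ _ _ _ Hij Hl' Hl _ Hly). }
      (* Here the existence of the union as a set is used: its largest element is found by
         minimization over a formula with [U] as parameter. *)
      destruct (max_exists U Hbd x Hx) as (y & Hy & Hmax).
      apply HU in Hy; destruct Hy as (i & l & Hl & Hly); exists i.
      intros j a b _ Ha Hb z (u & Hu & Hzu); exists y.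
      rewrite (Huniq _ _ _ Ha Hl); split; [exact Hly|].
      apply le_trans with u; [exact Hzu|]; apply Hmax, HU; eauto.
    (* With an empty union every range is empty, and stage 0 will do. *)
    - exists 0; intros j a b _ _ Hb z (u & Hu & _).
      exfalso; apply Hempty; exists u; apply HU; eauto. }
  destruct K as [i Hi]; exists i; intros j Hij.
  destruct (Htot i) as [a Ha]; [easy|]; destruct (Htot j) as [b Hb]; [easy|].
  destruct (value_exists a) as [v Hv].
  exists a, b, v; rewrite !HF; repeat split; auto.
  apply (value_of_down a); eauto; intros x; split; [|eapply Hi; eauto].
  apply down_sub, (Hmono i j); auto.
Qed.

(** Take [x] in the limit set, of color [c], and [y] in it beyond the bound of that fiber. Weak
    convergence tested on the set of just these two puts both into all late ranges, which are then
    inhomogeneous. *)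
Lemma functional_ASNIS (F L : sets M) :
  (forall l v, mmem M (pair l v) F <-> value l v) -> w_convergent L -> stable F L.
Proof.
  intros HF (_ & A & Hinf & Hconv).
  assert (Hbig : forall b, exists x, mmem M x A /\ b <= x).
  { intros b; apply NNPP; intros H; apply Hinf; exists b; intros x Hx.
    apply NNPP; intros Hb; apply H; exists x; split; [exact Hx|now apply not_lt]. }
  destruct (Hbig 0) as (x & Hx & _), (color x) as (c & Hc & Hxc), (Hfib c Hc) as [b Hb].
  destruct (Hbig b) as (y & Hy & Hby).
  destruct (bounded_comprehension M (fun z => z = x \/ z = y)) as [B HB]; [definability|].
  destruct (Hconv B) as [i Hi].
  { exists (x + y + 1); intros z Hz; apply lt_succ; apply HB in Hz.
    destruct Hz as [-> | ->]; apply le_iff; [exists y|exists x]; ring. }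
  apply (not_homogeneous_stable F L i HF); intros j Hj.
  destruct (Hi j Hj) as (l & Hl & E); exists l; split; [exact Hl|]; intros Hhom.
  assert (Hyc : mmem M (pair y c) f).
  { apply (Hhom x y c); auto; [apply (E x)|apply (E y)]; rewrite HB; auto. }
  apply Hb in Hyc; revert Hyc; now apply not_lt.
Qed.

Lemma restriction_exists (k : D) : exists g,
  func_on g (fun x => x <= k) (fun y => y <= n) /\
  forall x c, mmem M (pair x c) g -> mmem M (pair x c) f.
Proof.
  destruct (bounded_comprehension M (fun z => mmem M z f /\
    exists x, x < k + 1 /\ exists y, y < n + 1 /\ z = pair x y)) as [g Hg].
  { unfold pair; definability. }
  exists g; split; [|intros x c H; now apply Hg in H].
  repeat split.
  - intros z Hz; apply Hg in Hz; destruct Hz as (_ & x & Hx & y & Hy & E).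
    apply lt_succ in Hx, Hy; eauto.
  - intros x Hx; destruct (color x) as (c & Hc & Hxc); exists c; apply Hg.
    split; [exact Hxc|]; exists x; rewrite lt_succ; split; [exact Hx|].
    exists c; rewrite lt_succ; auto.
  - intros x y y' Hy Hy'; apply Hg in Hy, Hy'.
    exact (proj2 (proj2 Hf) _ _ _ (proj1 Hy) (proj1 Hy')).
Qed.

(** A constant coloring makes [l] homogeneous, so [v] is wide; a bijection from the numbers below
    [m'] then forces [m' < v], against [v < m']. *)
Lemma not_more_than_value (l v : D) :
  (forall x y, ran l x -> ran l y ->
     exists c, mmem M (pair x c) f /\ mmem M (pair y c) f) ->
  value l v -> ~ more_than (ran l) v.
Proof.
  intros Hconst Hv (m' & Hm' & g & (Hgr & Htot & _) & Hinj & _).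
  destruct Hv as [(_ & Hw & _)|[Hn _]].
  - apply (lt_irrefl v), (lt_trans _ _ _ Hm'), (injection_lt_wide l v m' g Hw); [|exact Hinj].
    intros x Hx; destruct (Htot x Hx) as [y Hy]; exists y; split; [|exact Hy].
    destruct (Hgr _ Hy) as (x' & y' & _ & Hy' & E); apply pair_inj in E.
    now destruct E as [_ ->].
  - apply Hn; intros x y c Hx Hy _ Hxc; destruct (Hconst x y Hx Hy) as (c' & Hxc' & Hyc').
    now rewrite (proj2 (proj2 Hf) _ _ _ Hxc Hxc').
Qed.

End Coloring.

Lemma sat_FIPP2_IPP : sat M (num_name M) (set_name M) (sentence (FIPP2 → IPP)%fml).
Proof.
  intros H.
  (* Satisfaction of the sentence unfolds by computation to this statement about the model. *)
  assert (H2 : forall n F,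
    func_on F any any /\ ext_functional F /\ (forall L, nested L -> stable F L) ->
    exists k, forall f, func_on f (fun x => x <= k) (fun y => y <= n) ->
      exists l, seq l /\ (forall x, ran l x -> x <= k)
        /\ (exists v, mmem M (pair l v) F /\ more_than (ran l) v)
        /\ forall x y, ran l x -> ran l y ->
             exists c, mmem M (pair x c) f /\ mmem M (pair y c) f) by exact H.
  clear H.
  change (forall n f, func_on f any (fun y => y <= n) ->
    exists c, c <= n /\ ~ bounded_class (fun x => mmem M (pair x c) f)).
  intros n f Hf; apply NNPP; intros Hno.
  assert (Hfib : forall c, c <= n -> bounded_class (fun x => mmem M (pair x c) f)).
  { intros c Hc; apply NNPP; intros H; apply Hno; eauto. }
  destruct (functional_exists n f) as (F & HFf & HFe & HF).
  destruct (H2 n F) as [k Hk].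
  { split; [exact HFf|]; split; [exact HFe|]; intros L.
    now apply (functional_AS n f). }
  destruct (restriction_exists n f Hf k) as (g & Hg & Hgf).
  destruct (Hk g Hg) as (l & _ & _ & (v & Hv & Hmore) & Hconst).
  revert Hmore; apply (not_more_than_value n f Hf); [|now apply HF].
  intros x y Hx Hy; destruct (Hconst x y Hx Hy) as (c & Hxc & Hyc); eauto.
Qed.

Lemma sat_FIPP3_IPP : sat M (num_name M) (set_name M) (sentence (FIPP3 → IPP)%fml).
Proof.
  intros H.
  assert (H3 : forall n F,
    func_on F any any /\ ext_functional F /\ (forall L, w_convergent L -> stable F L) ->
    exists k, forall f, func_on f (fun x => x <= k) (fun y => y <= n) ->
      exists l c, seq l /\ c <= n /\ (forall x, ran l x <-> mmem M (pair x c) f)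
        /\ exists v, mmem M (pair l v) F /\ more_than (ran l) v) by exact H.
  clear H.
  change (forall n f, func_on f any (fun y => y <= n) ->
    exists c, c <= n /\ ~ bounded_class (fun x => mmem M (pair x c) f)).
  intros n f Hf; apply NNPP; intros Hno.
  assert (Hfib : forall c, c <= n -> bounded_class (fun x => mmem M (pair x c) f)).
  { intros c Hc; apply NNPP; intros H; apply Hno; eauto. }
  destruct (functional_exists n f) as (F & HFf & HFe & HF).
  destruct (H3 n F) as [k Hk].
  { split; [exact HFf|]; split; [exact HFe|]; intros L.
    now apply (functional_ASNIS n f). }
  destruct (restriction_exists n f Hf k) as (g & Hg & Hgf).
  destruct (Hk g Hg) as (l & c & _ & _ & Heq & v & Hv & Hmore).
  revert Hmore; apply (not_more_than_value n f Hf); [|now apply HF].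
  intros x y Hx Hy; apply Heq in Hx, Hy; exists c; auto.
Qed.

End Arithmetic.

Lemma RCA0_completeness p :
  (forall M : RCA0_model, sat M (num_name M) (set_name M) p) -> proves RCA0 p.
Proof.
  intros H; apply completeness; [exact RCA0_subst_closed|].
  intros M v0 e0 Hgen Hax.
  exact (H (Build_RCA0_model M v0 e0 Hgen Hax)).
Qed.

Theorem theorem5p1 :
  proves RCA0 (sentence (FIPP2 → IPP)%fml) /\
  proves RCA0 (sentence (FIPP3 → IPP)%fml).
Proof.
  split; apply RCA0_completeness; intros M; [apply sat_FIPP2_IPP|apply sat_FIPP3_IPP].
Qed.
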